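(* Let $\rho$ be a unitary representation of the group $\mathrm{Hier}(\mathbb{T})$ in a Hilbert space $H$. For a nonempty finite subtree $J\subset\mathbb{T}$ let $H(J)\subset H$ be the subspace of $\mathcal{K}(J)$-fixed vectors and $P(J)$ the orthogonal projection to $H(J)$. For nonempty finite subtrees $J_1,J_2$ and $g\in\mathrm{Hier}(\mathbb{T})$ put $\widetilde\rho_{J_1,J_2}(g):=P(J_1)\rho(g)\big|_{H(J_2)}:H(J_2)\to H(J_1)$; this operator depends only on the double coset $\mathfrak{g}=\mathcal{K}(J_1)\,g\,\mathcal{K}(J_2)$ and is denoted $\widetilde\rho_{J_1,J_2}(\mathfrak{g})$. Then the maps $\mathfrak{g}\mapsto\widetilde\rho_{J_1,J_2}(\mathfrak{g})$ form a representation of the category whose objects are nonempty finite subtrees of $\mathbb{T}$, whose morphisms $J_2\to J_1$ are the elements of $\mathcal{K}(J_1)\backslash\mathrm{Hier}(\mathbb{T})/\mathcal{K}(J_2)$, and whose composition is $\odot$; i.e., for any $$\mathfrak{g}_1\in\mathcal{K}(J_1)\backslash\mathrm{Hier}(\mathbb{T})/\mathcal{K}(J_2),\qquad \mathfrak{g}_2\in\mathcal{K}(J_2)\backslash\mathrm{Hier}(\mathbb{T})/\mathcal{K}(J_3)$$ we have $$\widetilde\rho_{J_1,J_2}(\mathfrak{g}_1)\,\widetilde\rho_{J_2,J_3}(\mathfrak{g}_2)=\widetilde\rho_{J_1,J_3}(\mathfrak{g}_1\odot\mathfrak{g}_2).$$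
   Context: $\mathbb{T}$ is the tree (unique up to isomorphism) in which every vertex has countably infinite valence. A subtree $S\subset\mathbb{T}$ isomorphic to $\mathbb{T}$ is a $(\mathbb{T})$-subtree if only finitely many edges $[a,b]$ of $\mathbb{T}$ satisfy $a\in S$, $b\notin S$. A $(\mathbb{T})$-covering forest is a finite collection of pairwise disjoint $(\mathbb{T})$-subtrees obtained from $\mathbb{T}$ by removing a finite collection of edges (keeping all vertices). A spheromorphism $g$ is given by two $(\mathbb{T})$-covering forests $S_1,\dots,S_k$ and $R_1,\dots,R_k$ and tree isomorphisms $g^{(j)}:S_j\to R_j$; it is identified with the induced permutation of $\mathrm{vert}(\mathbb{T})$. $\mathrm{Hier}(\mathbb{T})\supset\mathrm{Aut}(\mathbb{T})$ is the group of all spheromorphisms. $\mathcal{K}(J)\subset\mathrm{Aut}(\mathbb{T})$ is the pointwise stabilizer of a finite subtree $J$. Topology: the subgroups $\mathcal{K}(J)$ are open in $\mathrm{Aut}(\mathbb{T})$ and define its topology; $\mathrm{Hier}(\mathbb{T})$ carries the group topology inducing this topology on $\mathrm{Aut}(\mathbb{T})$ and for which $\mathrm{Hier}(\mathbb{T})/\mathrm{Aut}(\mathbb{T})$ is discrete. Unitary representations are continuous. Bi-trees. Let $I,J$ be nonempty finite subtrees of $\mathbb{T}$. Let $\Gamma$ be a finite graph whose edges are colored black, blue, and red, equipped with embeddings $\imath:I\to\Gamma$, $\jmath:J\to\Gamma$. Denote by $\Gamma^{black}_{blue}$ the subgraph consisting of black and blue edges, by $\Gamma^{black}_{red}$ the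 subgraph consisting of black and red edges. $(\Gamma,\imath,\jmath)$ is an $(I,J)$-bi-tree if: the subgraphs $\Gamma^{black}_{blue}$ and $\Gamma^{black}_{red}$ are trees; $\imath(I)\subset\Gamma^{black}_{blue}$, $\jmath(J)\subset\Gamma^{black}_{red}$; any vertex of $\Gamma$ of valence 1 is an end of a black edge contained in $\imath(I)$ or $\jmath(J)$. Two $(I,J)$-bi-trees are equivalent if there is a color-preserving isomorphism $\lambda:\Gamma\to\Gamma'$ with $\imath'=\lambda\circ\imath$, $\jmath'=\lambda\circ\jmath$. Bi-tree of a spheromorphism $g$. A $(\mathbb{T})$-covering forest is compatible with $g$ if $g$ restricted to each of its trees is an embedding of trees; the perfect forest $\{S_\alpha\}$ of $g$ is the unique compatible one from which every compatible $(\mathbb{T})$-covering forest is obtained by removing finitely many edges. Paint blue the edges of $\mathbb{T}$ not in $\bigcup S_\alpha$ and red the edges of $\mathbb{T}$ not in $\bigcup gS_\alpha$. Let $\mathrm{Skel}_I$ be the minimal subtree of $\mathbb{T}$ containing $I$ and all blue edges, $\mathrm{Skel}_J$ the minimal subtree containing $J$ and all red edges, and $\Xi_k\subset S_k$ the minimal subtree containing $S_k\cap\mathrm{Skel}_I$ and $g^{-1}(gS_k\cap\mathrm{Skel}_J)$. The $(I,J)$-bi-tree of $g$ is the disjoint union of the $\Xi_k$ (all edges black), together with a blue edge joining $a,b$ for each blue edge $[a,b]$ and a red edge joining $g^{-1}a,g^{-1}b$ for each red edge $[a,b]$; $\imath$ is the inclusion and $\jmath=g^{-1}|_J$. This gives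 a one-to-one correspondence between double cosets $\mathcal{K}(J)\backslash\mathrm{Hier}(\mathbb{T})/\mathcal{K}(I)$ and $(I,J)$-bi-trees up to equivalence. Product. Let $\Delta$ be a $(J_2,J_1)$-bi-tree and $\Gamma$ a $(J_3,J_2)$-bi-tree. Glue $\Gamma$ and $\Delta$ identifying the images of the embeddings $J_2\to\Gamma$, $J_2\to\Delta$. After this, edges of $J_2$ can carry double colors. Replace ($\Delta$-blue, $\Gamma$-black) $\to$ blue, ($\Delta$-black, $\Gamma$-red) $\to$ red, ($\Delta$-black, $\Gamma$-black) $\to$ black, and remove ($\Delta$-blue, $\Gamma$-red)-edges (other combinations of colors on edges of $J_2$ are impossible). Finally, remove all vertices of valence 1 that are not contained in the images of $J_1$ and $J_3$, repeat this step again, etc. The result is a $(J_3,J_1)$-bi-tree $\Delta\diamond\Gamma$. The product $\mathfrak{g}_1\odot\mathfrak{g}_2\in\mathcal{K}(J_1)\backslash\mathrm{Hier}(\mathbb{T})/\mathcal{K}(J_3)$ is the double coset corresponding to $\Delta\diamond\Gamma$, where $\Delta$ is the $(J_2,J_1)$-bi-tree of $\mathfrak{g}_1$ and $\Gamma$ the $(J_3,J_2)$-bi-tree of $\mathfrak{g}_2$.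
   Formalization: In the gluing of Γ and Δ one rule is added: a pair of nonadjacent vertices of J_2 joined by a Γ-blue and a Δ-red edge gets a black edge; without it the glued graph has a double edge and corresponds to no double coset, so the product is undefined. *)

(* Defs.v *)
From HB Require Import structures.
From mathcomp Require Import all_boot all_order all_algebra sesquilinear.
From mathcomp Require Import complex.
From mathcomp Require Import boolp classical_sets functions cardinality.
From mathcomp Require Import reals topology normedtype.

Set Implicit Arguments.
Unset Strict Implicit.
Unset Printing Implicit Defensive.
Import Order.TTheory GRing.Theory Num.Theory Num.Def.
Import numFieldNormedType.Exports.

Local Open Scope classical_set_scope.
Local Open Scope card_scope.
Local Open Scope ring_scope.

(** * The tree *)

(* The tree T is only determined up to isomorphism, so it is an arbitrary
   structure of this type. *)
Record omega_tree := OmegaTree {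
  vert :> choiceType;
  adj : rel vert;
  adj_sym : symmetric adj;
  adj_irr : irreflexive adj;
  vert_inhabited : inhabited vert;
  adj_connected : forall x y, exists2 p, path adj x p & last x p = y;
  adj_acyclic : forall c, ucycle adj c -> (size c <= 2)%N;
  adj_valence : forall x, [set y | adj x y] #= [set: nat] }.

Section Trees.
Variable T : omega_tree.
Implicit Types (e : rel T) (S I J : set T) (F : set (set T)) (E : set (T * T)).

Definition reach e x y := exists2 p, path e x p & last x p = y.

Definition components e : set (set T) := range (fun x => [set y | reach e x y]).

(* Subgraphs of T that are trees are induced subgraphs: they are given by their
   sets of vertices. *)
Definition is_subtree S :=
  S !=set0 /\
  forall x y, S x -> S y -> reach [rel a b | [&& adj a b, a \in S & b \in S]] x y.

Definition fin_subtree J := is_subtree J /\ finite_set J.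

Definition hull S : set T := smallest is_subtree S.

Definition is_Tsubtree S :=
  [/\ is_subtree S,
      exists f : T -> T, [/\ injective f, range f = S &
        forall x y, adj (f x) (f y) = adj x y] &
      finite_set [set ab : T * T | [/\ adj ab.1 ab.2, S ab.1 & ~ S ab.2]]].

(* A forest is the set of (the vertex sets of) its trees. *)
Definition forest_edge F : rel T :=
  [rel a b | adj a b && `[< exists S, [/\ F S, S a & S b] >]].

Definition remove_edges F E : set (set T) :=
  components [rel a b | [&& forest_edge F a b, (a, b) \notin E & (b, a) \notin E]].

Definition obtained_by_removal F F' :=
  exists2 E, finite_set E & F' = remove_edges F E.

Definition covering_forest F :=
  [/\ finite_set F, F `<=` is_Tsubtree, trivIset F id &
      obtained_by_removal [set [set: T]] F].

End Trees.

(** * Permutations of the vertices and spheromorphisms *)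

Record vperm (T : omega_tree) := VPerm {
  vfun :> T -> T;
  vinv : T -> T;
  vfunK : cancel vfun vinv;
  vinvK : cancel vinv vfun }.

Section VPermGroup.
Variable T : omega_tree.
Implicit Types g h : vperm T.

Lemma vpermP g h : g =1 h -> g = h.
Proof.
case: g h => [f f' fK f'K] [k k' kK k'K] /= /funext fk.
rewrite -{}fk in kK k'K *.
have e : f' = k' by apply/funext => x; rewrite -{1}[x]k'K fK.
rewrite -{}e in kK k'K *.
by rewrite (Prop_irrelevance fK kK) (Prop_irrelevance f'K k'K).
Qed.

HB.instance Definition _ := gen_eqMixin (vperm T).
HB.instance Definition _ := gen_choiceMixin (vperm T).

Definition vperm_one : vperm T := @VPerm T id id (fun=> erefl) (fun=> erefl).

Definition vperm_inv g : vperm T := VPerm (@vinvK T g) (@vfunK T g).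

(* (g * h) x = g (h x) *)
Definition vperm_mul g h : vperm T :=
  VPerm (can_comp (@vfunK T g) (@vfunK T h)) (can_comp (@vinvK T h) (@vinvK T g)).

Fact vperm_mulA : associative vperm_mul.
Proof. by move=> f g h; apply: vpermP. Qed.
Fact vperm_mul1 : left_id vperm_one vperm_mul.
Proof. by move=> g; apply: vpermP. Qed.
Fact vperm_1mul : right_id vperm_one vperm_mul.
Proof. by move=> g; apply: vpermP. Qed.
Fact vperm_mulV : left_inverse vperm_one vperm_inv vperm_mul.
Proof. by move=> g; apply: vpermP => x /=; rewrite vfunK. Qed.
Fact vperm_Vmul : right_inverse vperm_one vperm_inv vperm_mul.
Proof. by move=> g; apply: vpermP => x /=; rewrite vinvK. Qed.

HB.instance Definition _ := isGroup.Build (vperm T)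
  vperm_mulA vperm_mul1 vperm_1mul vperm_mulV vperm_Vmul.

End VPermGroup.

Section Hier.
Variable T : omega_tree.
Implicit Types (g k : vperm T) (S I J : set T) (F : set (set T)).

Definition embeds_on g S := forall x y, S x -> S y -> adj (g x) (g y) = adj x y.

Definition image_forest g F : set (set T) := [set g @` S | S in F].

(* a subgroup of the group of all permutations of the vertices *)
Definition Hier : set (vperm T) := [set g | exists F,
  [/\ covering_forest F, covering_forest (image_forest g F) &
      forall S, F S -> embeds_on g S]].

Definition AutT : set (vperm T) := [set g | forall x y, adj (g x) (g y) = adj x y].

Definition K J : set (vperm T) := [set k | AutT k /\ forall x, J x -> k x = x].

(* The group topology of Hier(T) that induces on Aut(T) the topology defined by
   the K(J), and for which Hier(T) / Aut(T) is discrete, i.e. Aut(T) is open, has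
   the left cosets of the K(J) as a base of open sets. The subspace Hier(T) of
   the following topological space carries it. *)
Definition K_cosets : set (set (vperm T)) := [set A | exists g J,
  fin_subtree J /\ A = [set (g * k)%g | k in K J]].

HB.instance Definition _ :=
  isSubBaseTopological.Build (vperm T) K_cosets (id : set (vperm T) -> set (vperm T)).

Definition dcoset J1 g J2 : set (vperm T) :=
  [set (k1 * g * k2)%g | k1 in K J1 & k2 in K J2].

(* elements of K(J1) \ Hier(T) / K(J2), i.e. morphisms J2 -> J1 *)
Definition is_dcoset J1 J2 (D : set (vperm T)) :=
  exists2 g, Hier g & D = dcoset J1 g J2.

Definition compatible g F :=
  covering_forest F /\ forall S, F S -> embeds_on g S.

Definition is_perfect g F :=
  compatible g F /\ forall F', compatible g F' -> obtained_by_removal F F'.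

Definition perfect_forest g : set (set T) := xget set0 (is_perfect g).

End Hier.

(** * Bi-trees *)

Variant color := Black | Blue | Red.

(* The data underlying an (I, J)-bi-tree: a colored graph without multiple edges
   on the set [cset] of vertices, and maps whose restrictions to I and to J are
   the two embeddings. [ccol x y] is [None] when x and y are not adjacent. *)
Record cgraph (V : Type) := CGraph {
  cvert : Type;
  cset : set cvert;
  ccol : cvert -> cvert -> option color;
  cI : V -> cvert;
  cJ : V -> cvert }.

Arguments cset {V} c.
Arguments ccol {V} c.
Arguments cI {V} c.
Arguments cJ {V} c.

Definition cgraph_equiv (V : Type) (I J : set V) (G G' : cgraph V) :=
  exists l : cvert G -> cvert G',
    [/\ set_bij (cset G) (cset G') l,
        forall x y, cset G x -> cset G y -> ccol G' (l x) (l y) = ccol G x y,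
        forall u, I u -> cI G' u = l (cI G u) &
        forall u, J u -> cJ G' u = l (cJ G u)].

Section BiTreeOf.
Variables (T : omega_tree) (g : vperm T) (I J : set T).

Let F := perfect_forest g.

Definition blue_edge : rel T := [rel a b | adj a b && ~~ forest_edge F a b].

Definition red_edge : rel T :=
  [rel a b | adj a b && ~~ forest_edge (image_forest g F) a b].

Definition skelI : set T := hull (I `|` [set a | exists b, blue_edge a b]).

Definition skelJ : set T := hull (J `|` [set a | exists b, red_edge a b]).

Definition Xi (S : set T) : set T :=
  hull ((S `&` skelI) `|` g @^-1` ((g @` S) `&` skelJ)).

Definition bitree : cgraph T :=
  {| cvert := T;
     cset := \bigcup_(S in F) Xi S;
     ccol := fun x y =>
       if `[< exists S, [/\ F S, Xi S x, Xi S y & adj x y] >] then Some Black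
       else if blue_edge x y then Some Blue
       else if red_edge (g x) (g y) then Some Red
       else None;
     cI := id;
     cJ := (g^-1)%g |}.

End BiTreeOf.

(** * The product of bi-trees *)

(* [merge_color c d] is the color of a pair of vertices which carries the color
   [c] in Gamma and the color [d] in Delta. (Gamma red, Delta blue)-edges are
   removed; the other combinations sent to [None] by the last case cannot occur.
   (Gamma blue, Delta red) cannot occur on an edge of J2, but it can occur on a
   pair of nonadjacent vertices of J2: the second factor of the product destroys
   an edge (going from J3 to J2) and the first factor restores it. The product
   preserves this edge, so it is black: it belongs both to the black-blue and to
   the black-red tree. *)
Definition merge_color (c d : option color) : option color :=
  match c, d with
  | None, _ => d
  | _, None => c
  | Some Black, Some Blue => Some Blue
  | Some Red, Some Black => Some Red
  | Some Black, Some Black => Some Black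
  | Some Blue, Some Red => Some Black
  | _, _ => None
  end.

Section Diamond.
Variables (V : Type) (J1 J2 J3 : set V).
(* D is a (J2, J1)-bi-tree, G is a (J3, J2)-bi-tree *)
Variables D G : cgraph V.

(* The glued vertex set is represented by the vertices of G together with the
   vertices of D outside the image of J2. *)
Let W : Type := (cvert G + cvert D)%type.

Definition glue_inr (y : cvert D) : W :=
  if pselect (exists w, J2 w /\ cI D w = y) is left h
  then inl (cJ G (sval (cid h))) else inr y.

Definition glue_set : set W := [set inl x | x in cset G] `|` glue_inr @` cset D.

Definition glue_fstcol (p q : W) : option color :=
  match p, q with inl x, inl y => ccol G x y | _, _ => None end.

Definition glue_toD (p : W) : option (cvert D) :=
  match p with
  | inl x => if pselect (exists w, J2 w /\ cJ G w = x) is left h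
             then Some (cI D (sval (cid h))) else None
  | inr y => Some y
  end.

Definition glue_sndcol (p q : W) : option color :=
  match glue_toD p, glue_toD q with
  | Some x, Some y => ccol D x y
  | _, _ => None
  end.

Definition glue : cgraph V :=
  {| cvert := W;
     cset := glue_set;
     ccol := fun p q => merge_color (glue_fstcol p q) (glue_sndcol p q);
     cI := fun u => inl (cI G u);
     cJ := fun u => glue_inr (cJ D u) |}.

Definition valence1 (A : set W) (p : W) :=
  exists! q : W, A q /\ ccol glue p q <> None.

Definition trim_step (A : set W) : set W := [set p | A p /\
  (valence1 A p -> (cI glue @` J3) p \/ (cJ glue @` J1) p)].

(* the (J3, J1)-bi-tree Delta <> Gamma; the intersection is stationary since
   [glue_set] is finite *)
Definition diamond : cgraph V :=
  {| cvert := W;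
     cset := \bigcap_(n in [set: nat]) iter n trim_step glue_set;
     ccol := ccol glue;
     cI := cI glue;
     cJ := cJ glue |}.

End Diamond.

(* the double coset whose bi-tree is the product of the bi-trees of D1 and D2 *)
Definition odot (T : omega_tree) (J1 J2 J3 : set T) (D1 D2 : set (vperm T)) :
    set (vperm T) :=
  [set g | Hier g /\ exists g1 g2, [/\ D1 g1, D2 g2 &
     cgraph_equiv J3 J1 (bitree g J3 J1)
       (diamond J1 J2 J3 (bitree g1 J2 J1) (bitree g2 J3 J2))]].

(** * Unitary representations *)

Section Representations.
Variables (R : realType) (H : completeNormedModType R[i]).

(* with the completeness of H, this makes H a Hilbert space *)
Definition norm_from_dot (dot : {dot H for conjC}) :=
  forall v : H, dot v v = `|v| ^+ 2.

Variable dot : {dot H for conjC}.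

Definition unitary (u : H -> H) :=
  [/\ linear u, forall v w, dot (u v) (u w) = dot v w & forall w, exists v, u v = w].

(* The value of rho outside Hier(T) is irrelevant. *)
Definition unitary_rep (T : omega_tree) (rho : vperm T -> H -> H) :=
  [/\ forall g, Hier g -> unitary (rho g),
      forall g h, Hier g -> Hier h -> forall v, rho (g * h)%g v = rho g (rho h v) &
      forall v, {within @Hier T, continuous (fun g => rho g v)}].

Definition orth_proj (A : set H) (v : H) : H :=
  xget 0 [set w | A w /\ forall u, A u -> dot (v - w) u = 0].

Variables (T : omega_tree) (rho : vperm T -> H -> H).

Definition fixed (J : set T) : set H := [set v | forall k, K J k -> rho k v = v].

(* the operator H(J2) -> H(J1) is the restriction of this map to H(J2) *)
Definition rho_tilde (J1 : set T) (g : vperm T) (v : H) : H :=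
  orth_proj (fixed J1) (rho g v).

Definition rho_tilde_dcoset (J1 : set T) (D : set (vperm T)) (v : H) : H :=
  rho_tilde J1 (xget 1%g D) v.

End Representations.

(* Main.v *)
(* A permutation g is a spheromorphism iff adj and its pull-back by g differ on
   finitely many pairs. The bi-tree of g lives on the least set which is convex for
   both of these trees and contains I, g^-1 J and the ends of all pairs on which they
   differ; the colour of a pair records its two adjacencies. An isomorphism of
   bi-trees extends to the whole tree by back and forth, so the bi-tree determines
   the double coset.

   Call k in K(J2) generic if k g2 maps the vertices of the bi-tree of g2 to
   vertices off the bi-tree of g1, except for those which land in J2. For generic k
   the glued graph is the union of the two bi-trees inside T, and trimming its leaves
   gives the bi-tree of g1 k g2. Hence the product is the double coset of g1 k g2.

   On the other hand, generic elements form a single double coset of the stabilizers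
   of the two bi-trees, so the matrix coefficient of rho(k) is the same for all of
   them. A minimal norm argument shows that it vanishes on the complement of H(J2),
   i.e. rho(k) acts as P(J2), and P(J1) rho(g1) P(J2) rho(g2) = P(J1) rho(g1 k g2)
   on H(J3). *)

Require Import Defs.
From mathcomp Require Import all_boot all_order all_algebra sesquilinear complex.
From mathcomp Require Import finmap boolp classical_sets functions cardinality.
From mathcomp Require Import reals topology normedtype ring lra.

Set Implicit Arguments.
Unset Strict Implicit.
Unset Printing Implicit Defensive.

Local Open Scope classical_set_scope.

(** * Paths, connected sets and convex sets *)

(** All extension arguments rest on one fact: in a forest, a vertex outside a connected set has at
    most one neighbour in it. So, when a finite core is connected for both adjacencies and these
    agree off the core, a new vertex is attached to it in a single way, and infinite valence always
    leaves a fresh vertex of the same kind on the other side. The single back-and-forth built on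
    this gives the model isomorphism of a subtree, the recovery of a double coset from its bi-tree,
    the existence of generic elements, and their uniqueness up to stabilizers.

    Stabilizers of bi-trees enter the analysis as follows. An automorphism fixing the bi-tree of [g]
    pointwise preserves both tree structures, hence its conjugate by [g] is again an automorphism.
    Therefore vectors of H(J1) moved by [g1^-1], and vectors of H(J3) moved by [g2], are fixed by
    the stabilizers of the two bi-trees, now both placed in the middle copy of the tree. The
    identity of operators becomes a statement about the coefficient of [rho k] between two such
    vectors.

    [odot] allows any representatives of the two double cosets, so a generic element for one pair
    has to be compared with one for every other pair. *)

Section Paths.
Variable T : omega_tree.
Implicit Types (e : rel T) (A B C : set T) (x y z : T) (p : seq T).

Definition restr A e : rel T := [rel a b | [&& e a b, a \in A & b \in A]].

Definition conn e A := forall x y, A x -> A y -> reach (restr A e) x y.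

(** Unlike [conn], this passes to intersections for any relation, so least sets can be formed with
    it. In a forest [conn] implies it, and the converse holds when [e] connects all vertices. *)
Definition convex e A := forall x p, path e x p -> uniq (x :: p) ->
  A x -> A (last x p) -> forall z, z \in p -> A z.

(** An edge walked back and forth is a [ucycle] of size 2, hence the bound. *)
Definition forest_rel e :=
  [/\ symmetric e, irreflexive e & forall c, ucycle e c -> size c <= 2].

Lemma reach_refl e x : reach e x x.
Proof. by exists [::]. Qed.

Lemma reach1 e x y : e x y -> reach e x y.
Proof. by exists [:: y] => //=; rewrite andbT. Qed.

Lemma reach_trans e x y z : reach e x y -> reach e y z -> reach e x z.
Proof.
by case=> p ep <- [q eq <-]; exists (p ++ q); rewrite ?cat_path ?ep ?last_cat.
Qed.

Lemma reach_sym e x y : symmetric e -> reach e x y -> reach e y x.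
Proof.
move=> es [p ep <-]; exists (rev (belast x p)).
  by rewrite rev_path; apply: sub_path ep => a b; rewrite /= es.
by case: p ep => //= a p _; rewrite rev_cons last_rcons.
Qed.

Lemma reach_sub e e' x y : subrel e e' -> reach e x y -> reach e' x y.
Proof. by move=> ee [p ep <-]; exists p => //; apply: sub_path ep. Qed.

Lemma reach_ind e (P : T -> Prop) x y :
  (forall a b, e a b -> P a -> P b) -> P x -> reach e x y -> P y.
Proof.
move=> Pe Px [p]; elim: p x Px => [|z p IH] x Px /=; first by move=> _ <-.
by move=> /andP[exz ep] zy; apply: (IH z) => //; apply: Pe exz Px.
Qed.

Lemma reach_uniq e x y : reach e x y ->
  exists p, [/\ path e x p, last x p = y & uniq (x :: p)].
Proof. by case=> p ep <-; case: (shortenP ep) => q eq uq _; exists q. Qed.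

Lemma restr_sym A e : symmetric e -> symmetric (restr A e).
Proof. by move=> es x y; rewrite /restr /= es andbCA andbC -andbA. Qed.

Lemma restrS A B e : A `<=` B -> subrel (restr A e) (restr B e).
Proof.
move=> AB x y /and3P[exy Ax Ay]; apply/and3P; split=> //.
  by move: Ax; rewrite !inE; apply: AB.
by move: Ay; rewrite !inE; apply: AB.
Qed.

Lemma restr1 A e x y : e x y -> A x -> A y -> reach (restr A e) x y.
Proof. by move=> exy Ax Ay; apply: reach1; apply/and3P; rewrite !inE. Qed.

Lemma path_restr A e x p : path (restr A e) x p ->
  path e x p /\ forall z, z \in p -> A z.
Proof.
elim: p x => //= y p IH x /andP[/and3P[exy Ax]]; rewrite inE => Ay /IH[ep Ap].
by split=> [|z]; rewrite ?exy // inE => /predU1P[->|/Ap].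
Qed.

Lemma restr_path A e x p : path e x p -> (forall z, z \in x :: p -> A z) ->
  path (restr A e) x p.
Proof.
elim: p x => //= y p IH x /andP[exy ep] Ap; apply/andP; split.
  by apply/and3P; rewrite !inE; split=> //; apply: Ap; rewrite !inE eqxx ?orbT.
by apply: IH => // z zp; apply: Ap; rewrite inE zp orbT.
Qed.

Lemma reach_restr_exit A C e x y : reach (restr A e) x y -> C x -> ~ C y ->
  exists a b, [/\ C a, A b, ~ C b & e a b].
Proof.
move=> [p]; elim: p x => [|z p IH] x /=; first by move=> _ <-.
move=> /andP[/and3P[exz _]]; rewrite inE => Az ep pl Cx Cy.
have [Cz|Cz] := pselect (C z); first exact: (IH z).
by exists x, z.
Qed.

Lemma conn_setU1 e A a x : symmetric e -> conn e A -> A a -> e a x ->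
  conn e (x |` A).
Proof.
move=> es Ac Aa eax; have AB : A `<=` x |` A by move=> ?; right.
have ra y : (x |` A) y -> reach (restr (x |` A) e) a y.
  case=> [->|Ay]; first by apply: restr1 => //; [right|left].
  by apply: reach_sub (Ac _ _ Aa Ay); apply: restrS.
move=> y z /ra ay /ra; apply: reach_trans; apply: reach_sym ay.
exact: restr_sym.
Qed.

Lemma conn_star e A B : symmetric e -> conn e A -> A `<=` B ->
  (forall b, B b -> exists2 a, A a & reach (restr B e) b a) -> conn e B.
Proof.
move=> es Ac AB BA x y Bx By.
have [[a Aa xa] [b Ab yb]] := (BA x Bx, BA y By).
apply: reach_trans xa _; apply: reach_trans (reach_sub _ (Ac _ _ Aa Ab)) _.
  exact: restrS.
by apply: reach_sym yb; apply: restr_sym.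
Qed.

Lemma conn_setU e A B w : symmetric e -> conn e A -> conn e B -> A w -> B w ->
  conn e (A `|` B).
Proof.
move=> es Ac Bc Aw Bw; apply: (conn_star es Ac) => [?|b]; first by left.
case=> [Ab|Bb]; first by exists b => //; apply: reach_refl.
exists w => //; apply: reach_sub (Bc _ _ Bb Bw); apply: restrS.
by move=> ?; right.
Qed.

(* Follow an [e']-path until it first meets [A]: up to that point it is also an
   [e]-path. *)
Lemma conn_agree e e' A B : symmetric e -> A !=set0 -> conn e A -> A `<=` B ->
  conn e' B -> (forall x y, ~ (A x /\ A y) -> e x y = e' x y) -> conn e B.
Proof.
move=> es [w Aw] Ac AB Bc ag; apply: (conn_star es Ac AB) => b Bb.
have [p] := Bc _ _ Bb (AB _ Aw); elim: p b Bb => [|z p IH] b Bb /=.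
  by move=> _ ->; exists w => //; apply: reach_refl.
move=> /andP[/and3P[ebz _]]; rewrite inE => Bz ep pw.
have [Ab|Ab] := pselect (A b); first by exists b => //; apply: reach_refl.
have [a Aa za] := IH z Bz ep pw; exists a => //; apply: reach_trans za.
by apply: restr1 => //; rewrite ag// => -[].
Qed.

Lemma path_reach_restr e A x p y : path e x p -> (forall z, z \in x :: p -> A z) ->
  y \in x :: p -> reach (restr A e) x y.
Proof.
move=> ep Ap yp; move: ep Ap; case/splitPl: yp => p1 p2 <-.
rewrite cat_path => /andP[ep1 _] Ap; exists p1 => //; apply: restr_path => // z zp.
by apply: Ap; rewrite -cat_cons mem_cat zp.
Qed.

(** A union of chosen paths from [x0] to the points of [A]. It need not be minimal: it only serves
    as a finite upper bound. *)
Lemma finite_conn_hull e A x0 : (forall x y, reach e x y) -> symmetric e ->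
  finite_set A -> A x0 -> exists B, [/\ finite_set B, A `<=` B & conn e B].
Proof.
move=> er es fA Ax0.
have /choice[f fP] : forall x, exists p, path e x0 p /\ last x0 p = x.
  by move=> x; have [p] := er x0 x; exists p.
exists (\bigcup_(x in A) [set` x0 :: f x]); split.
- by apply: bigcup_finite => // x _; apply: finite_seq.
- by move=> x Ax; exists x => //=; rewrite -{1}(fP x).2 mem_last.
apply: (@conn_star _ [set x0]) => //.
- by move=> x y -> ->; apply: reach_refl.
- by move=> _ ->; exists x0 => //=; rewrite inE eqxx.
move=> b [x Ax bx]; exists x0 => //; apply: reach_sym; first exact: restr_sym.
by apply: path_reach_restr bx => [|z zp]; [exact: (fP x).1|exists x].
Qed.

End Paths.

Lemma card_fset_set_proper (T : choiceType) (A B : set T) : finite_set B ->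
  A `<=` B -> (exists2 x, B x & ~ A x) -> #|` fset_set A| < #|` fset_set B|.
Proof.
move=> fB AB [x Bx Ax]; have fA := sub_finite_set AB fB.
apply: fproper_ltn_card; rewrite fproperE; apply/andP; split.
  by rewrite -fset_set_sub.
by apply/negP; rewrite -fset_set_sub// => /(_ x Bx).
Qed.

(** * Simple paths, convexity and leaves in forests *)

Section Forests.
Variable T : omega_tree.
Implicit Types (e : rel T) (A B C : set T) (x y z : T) (p : seq T).

(* Otherwise shortening the path from [x] to [y] and closing it through [a] gives
   a cycle. *)
Lemma forest_nbr e a x y p : forest_rel e -> path e x p -> last x p = y ->
  a \notin x :: p -> e a x -> e a y -> x = y.
Proof.
case=> es _ ec ep <-; case: (shortenP ep) => q eq uq qp anp eax eay.
have anq : a \notin x :: q.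
  by apply: contra anp; rewrite !inE => /predU1P[->|/qp ->]; rewrite ?eqxx ?orbT.
have : size [:: a, x & q] <= 2.
  apply: ec; apply/andP; split; last by apply/andP.
  by rewrite /= eax rcons_path eq /= es eay.
by case: (q).
Qed.

Lemma conn_nbr e A a x y : forest_rel e -> conn e A -> ~ A a -> A x -> A y ->
  e a x -> e a y -> x = y.
Proof.
move=> fe Ac Aa Ax Ay; have [p /path_restr[ep Ap] pl] := Ac _ _ Ax Ay.
apply: (forest_nbr fe ep pl); rewrite inE; apply/negP => /predU1P[ax|/Ap//].
by apply: Aa; rewrite ax.
Qed.

Lemma uniq_path_eq e x p q : forest_rel e -> path e x p -> path e x q ->
  uniq (x :: p) -> uniq (x :: q) -> last x p = last x q -> p = q.
Proof.
move=> fe; have es : symmetric e by case: fe.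
elim: p x q => [|y p IH] x [|z q] //=.
- by move=> _ _ _ /andP[+ _] xl; rewrite {1}xl mem_last.
- by move=> _ _ /andP[+ _] _ xl; rewrite -{1}xl mem_last.
move=> /andP[exy ep] /andP[exz eq] /andP[xp up] /andP[xq uq] l.
suff yz : y = z by subst z; rewrite (IH y q).
(* If the first steps [y] and [z] differed, the two tails would join them through the common end
   while avoiding [x], against [forest_nbr]. *)
have [r er rl] : reach (restr [set w | w != x] e) y z.
  apply: (@reach_trans _ _ _ (last y p)).
    apply: (@path_reach_restr _ _ _ _ p) => //; last exact: mem_last.
    by move=> w wp; apply: contraNneq xp => <-.
  rewrite l; apply: reach_sym; first exact: restr_sym.
  apply: (@path_reach_restr _ _ _ _ q) => //; last exact: mem_last.
  by move=> w wp; apply: contraNneq xq => <-.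
have [er' rx] := path_restr er.
apply: (forest_nbr fe er' rl) exy exz.
rewrite inE; apply/norP; split; first by apply: contraNneq xp => ->; rewrite inE eqxx.
by apply/negP => /rx /=; rewrite eqxx.
Qed.

Lemma conn_convex e A : forest_rel e -> conn e A -> convex e A.
Proof.
move=> fe Ac x p ep up Ax Al z zp.
have [q [eq ql uq]] := reach_uniq (Ac _ _ Ax Al).
have [eq' qA] := path_restr eq.
by rewrite (uniq_path_eq fe ep eq' up uq) in zp => //; apply: qA.
Qed.

Lemma convex_conn e A : (forall x y, reach e x y) -> convex e A -> conn e A.
Proof.
move=> er cA x y Ax Ay; have [p [ep pl up]] := reach_uniq (er x y).
exists p => //; apply: restr_path => // z; rewrite inE => /predU1P[->//|].
by apply: cA ep up Ax _ z; rewrite pl.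
Qed.

Lemma convexI e A B : convex e A -> convex e B -> convex e (A `&` B).
Proof.
move=> cA cB x p ep up [Ax Bx] [Al Bl] z zp.
by split; [apply: cA ep up Ax Al z zp|apply: cB ep up Bx Bl z zp].
Qed.

(* The edge would lie on the path from [A `&` B] to [u], hence inside [B]. *)
Lemma conn_not_adj e A B u v : forest_rel e -> conn e A -> conn e B ->
  A `&` B !=set0 -> B u -> ~ A u -> A v -> ~ B v -> e u v = false.
Proof.
move=> fe Ac Bc [w [Aw Bw]] Bu Au Av Bv; apply/negP => euv; apply: Bv.
have es : symmetric e by case: fe.
have [p [ep pl up]] := reach_uniq (Ac _ _ Aw Av).
have [ep' Ap] := path_restr ep.
have [vw|vw] := eqVneq v w; first by rewrite vw.
apply: (conn_convex fe Bc (x := w) (p := rcons p u)); rewrite ?last_rcons//.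
- by rewrite rcons_path ep' pl es.
- rewrite -rcons_cons rcons_uniq up andbT; apply/negP.
  by rewrite inE => /predU1P[uw|/Ap//]; apply: Au; rewrite uw.
- rewrite mem_rcons inE; move: (mem_last w p).
  by rewrite pl inE (negPf vw) => /= ->; rewrite orbT.
Qed.

(** Grow [C] inside [A] by one adjacent vertex at a time; the last vertex added is the leaf, because
    its neighbours in [A] lie in a connected set not containing it. *)
Lemma conn_leaf e A C : forest_rel e -> finite_set A -> conn e A -> conn e C ->
  C !=set0 -> C `<=` A -> C <> A ->
  exists u v, [/\ A u, ~ C u, A v, e u v & forall w, A w -> e u w -> w = v].
Proof.
move=> fe fA Ac; have es : symmetric e by case: fe.
have [n] := ubnP #|` fset_set (A `\` C)|; elim: n C => // n IH C ltn Cc [c Cc0] CA CnA.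
have [b [Ab Cb]] : exists b, A b /\ ~ C b.
  apply: contra_notP CnA => /forallNP H; apply/seteqP; split=> // x Ax.
  by have /not_andP[//|/contrapT] := H x.
have [a [x [Ca Ax Cx eax]]] := reach_restr_exit (Ac _ _ (CA _ Cc0) Ab) Cc0 Cb.
have C'c := conn_setU1 es Cc Ca eax.
have C'A : x |` C `<=` A by move=> y [->|/CA].
have [AE|AE] := pselect (x |` C = A).
  exists x, a; split=> //; [exact: CA|by rewrite es|].
  move=> r; rewrite -{1}AE => -[->|Cr exr]; first by case: fe => _ -> _.
  by apply: (conn_nbr fe Cc Cx Cr Ca exr); rewrite es.
have [||p [q [Ap C'p Aq epq pq]]] := IH _ _ C'c _ C'A AE; last 1 first.
- by exists p, q; split=> // Cp; apply: C'p; right.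
- rewrite ltnS in ltn; apply: leq_trans ltn; apply: card_fset_set_proper.
  + exact: finite_setD.
  + by move=> y [Ay Cy]; split=> // Cy'; apply: Cy; right.
  + by exists x; [split|case=> _; apply; left].
- by exists x; left.
Qed.

End Forests.

(** * Countability of the tree *)

Section Omega.
Variable T : omega_tree.

Lemma adj_forest : forest_rel (@adj T).
Proof.
by split; [exact: adj_sym|exact: adj_irr|exact: adj_acyclic].
Qed.

(** The ends of walks of length [n] from a base point form a countable set, by induction on [n]. The
    enumeration, possibly with repetitions, schedules the back-and-forth. *)
Lemma omega_enum : exists f : nat -> T, forall x, exists n, f n = x.
Proof.
have [x0] := vert_inhabited T.
pose B n := [set y | exists p, [/\ path (@adj T) x0 p, last x0 p = y & size p = n]].
have Bc n : countable (B n).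
  elim: n => [|n IH].
    apply: sub_countable (countable1 x0); apply: subset_card_le => y.
    by case=> -[|z p] [_ <-].
  have H : countable (\bigcup_(y in B n) [set z | adj y z]).
    apply: bigcup_countable => // y _.
    by rewrite (eq_countable (adj_valence y)); apply: countableP.
  apply: sub_countable H; apply: subset_card_le => y [p].
  case/lastP: p => [|p z] [] //; rewrite rcons_path last_rcons size_rcons.
  by move=> /andP[ep ez] <- [pn]; exists (last x0 p) => //; exists p.
have Tc : countable [set: T].
  have H : countable (\bigcup_n B n) by apply: bigcup_countable.
  apply: sub_countable H; apply: subset_card_le => y _.
  by have [p ep py] := adj_connected x0 y; exists (size p) => //; exists p.
have /countable_injP[f fi] := Tc.
exists (fun n => xget x0 [set x | f x = n]) => x; exists (f x).
apply: fi; rewrite ?inE//.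
by have : [set y | f y = f x] (xget x0 [set y | f y = f x]) by apply: xgetPex; exists x.
Qed.

End Omega.

(** * Back and forth *)

Section BackAndForth.
Variable T : omega_tree.

(** Two instances matter: all of [T] with [adj] and its pull-back by a spheromorphism, and a subset
    of [T] with [adj] taken twice, for isomorphisms from [T] onto a subtree. *)
Record bigraph := Bigraph { bset : set T; brel1 : rel T; brel2 : rel T }.
Implicit Types (B : bigraph) (A : set T) (R Q : set (T * T)).

(* Outside a core the two graphs agree, so an isomorphism between finite cores can
   be extended one vertex at a time. *)
Definition core B A :=
  [/\ A `<=` bset B, conn (brel1 B) A, conn (brel2 B) A &
    forall x y, bset B x -> bset B y -> ~ (A x /\ A y) ->
      brel1 B x y = brel2 B x y].

Definition ample B :=
  [/\ forest_rel (brel1 B), forest_rel (brel2 B), conn (brel1 B) (bset B) &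
    forall x, bset B x ->
      infinite_set [set y | [/\ bset B y, brel1 B x y & brel2 B x y]]].

(** A partial isomorphism is a set of pairs rather than a function, so that the back step is the
    forth step for [swap R]. *)
Record piso B B' R : Prop := Piso {
  piso_fin : finite_set R;
  piso_n0 : R !=set0;
  piso_inj : forall u v, R u -> R v -> u.1 = v.1 <-> u.2 = v.2;
  piso_rel1 : forall u v, R u -> R v -> brel1 B u.1 v.1 = brel1 B' u.2 v.2;
  piso_rel2 : forall u v, R u -> R v -> brel2 B u.1 v.1 = brel2 B' u.2 v.2;
  piso_dom : core B (fst @` R);
  piso_ran : core B' (snd @` R) }.

Definition swap R : set (T * T) := [set u | R (u.2, u.1)].

Lemma fst_swap R : fst @` swap R = snd @` R.
Proof.
apply/seteqP; split=> x [[a b] Rab <-] /=; first by exists (b, a).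
by exists (b, a).
Qed.

Lemma snd_swap R : snd @` swap R = fst @` R.
Proof.
apply/seteqP; split=> x [[a b] Rab <-] /=; first by exists (b, a).
by exists (b, a).
Qed.

Lemma piso_swap B B' R : piso B B' R -> piso B' B (swap R).
Proof.
case=> fR [[a b] Rab] Ri R1 R2 Rd Rr; split.
- have -> : swap R = (fun u => (u.2, u.1)) @` R.
    apply/seteqP; split=> [[x y] Rxy|_ [[x y] Rxy <-] //]; by exists (y, x).
  exact: finite_image.
- by exists (b, a).
- move=> [x y] [x' y'] Rx Ry; have /= [H1 H2] := Ri _ _ Rx Ry.
  by split; [exact: H2|exact: H1].
- by move=> [x y] [x' y'] Rx Ry /=; have /= := R1 _ _ Rx Ry.
- by move=> [x y] [x' y'] Rx Ry /=; have /= := R2 _ _ Rx Ry.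
- by rewrite fst_swap.
- by rewrite snd_swap.
Qed.

Lemma core_setU1 B A a x : ample B -> core B A -> bset B x -> ~ A x -> A a ->
  brel1 B a x -> core B (x |` A).
Proof.
move=> [[s1 _ _] [s2 _ _] _ _] [AB c1 c2 ag] Bx Ax Aa ax; split.
- by move=> y [->//|/AB].
- exact: conn_setU1 s1 c1 Aa ax.
- by apply: (conn_setU1 s2 c2 Aa); rewrite -(ag a x (AB _ Aa) Bx)// => -[].
- by move=> y z By Bz A'; apply: ag => // -[Ay Az]; apply: A'; split; right.
Qed.

Lemma core_nbr B A a b x : ample B -> core B A -> bset B x -> ~ A x -> A a ->
  A b -> brel1 B x a -> brel1 B x b = `[< a = b >].
Proof.
move=> [f1 _ _ _] [AB c1 _ _] Bx Ax Aa Ab xa.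
apply/idP/asboolP => [xb|<-//]; exact: (conn_nbr f1 c1 Ax).
Qed.

(** In [brel1] the vertex [x] sees only [a] in the core, and [y] only [a']. In [brel2] both see the
    same as in [brel1], since the relations agree off the cores. [X] is a finite set of forbidden
    images. *)
Lemma piso_step B B' R (X : set T) a x : ample B -> ample B' -> piso B B' R ->
  finite_set X -> (fst @` R) a -> bset B x -> ~ (fst @` R) x -> brel1 B a x ->
  exists y, ~ X y /\ piso B B' ((x, y) |` R).
Proof.
move=> aB aB' pR fX [[a0 a'] Ra /= a0a] Bx Rx ax; subst a0.
have [[s1 i1 _] [s2 i2 _] _ _] := aB.
have [[s1' i1' _] [s2' i2' _] _ inf'] := aB'.
have [fR R0 Ri R1 R2 Rd Rr] := pR.
have Ra' : (snd @` R) a' by exists (a, a').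
have Ra1 : (fst @` R) a by exists (a, a').
have [AB c1 c2 ag] := Rd; have [AB' c1' c2' ag'] := Rr.
have fX' : finite_set (X `|` snd @` R).
  by rewrite finite_setU; split=> //; apply: finite_image.
(* By ampleness [a'] has infinitely many neighbours common to both relations, and only finitely many
   lie in [X] or in the range. *)
have [y [[B'y ya ya2] /not_orP[Xy Ry]]] : exists y,
    [/\ bset B' y, brel1 B' a' y & brel2 B' a' y] /\ ~ (X `|` snd @` R) y.
  have /infinite_setN0 : infinite_set
    ([set y | [/\ bset B' y, brel1 B' a' y & brel2 B' a' y]] `\` (X `|` snd @` R)).
    by apply: infinite_setD => //; apply: inf'; apply: AB'.
  by case=> y [? ?]; exists y.
have fstU : fst @` ((x, y) |` R) = x |` fst @` R by rewrite image_setU image_set1.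
have sndU : snd @` ((x, y) |` R) = y |` snd @` R by rewrite image_setU image_set1.
have E1 b b' : R (b, b') -> brel1 B x b = brel1 B' y b'.
  move=> Rb.
  rewrite (core_nbr (a := a) aB Rd)//; [|by exists (b, b')|by rewrite s1].
  rewrite (core_nbr (a := a') aB' Rr)//; [|by exists (b, b')|by rewrite s1'].
  exact/asbool_equiv_eq/(Ri _ _ Ra Rb).
have E2 b b' : R (b, b') -> brel2 B x b = brel2 B' y b'.
  move=> Rb; have Bb : bset B b by apply: AB; exists (b, b').
  have Bb' : bset B' b' by apply: AB'; exists (b, b').
  by rewrite -(ag _ _ Bx Bb) -?(ag' _ _ B'y Bb') ?(E1 _ _ Rb)// => -[].
exists y; split=> //; split.
- by rewrite finite_setU; split=> //; apply: finite_set1.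
- by exists (x, y); left.
- move=> [u u'] [v v'] [[-> ->]|Ru] [[-> ->]|Rv] //=; last exact: (Ri _ _ Ru Rv).
  + by split=> E; exfalso; [apply: Rx|apply: Ry]; exists (v, v').
  + by split=> E; exfalso; [apply: Rx|apply: Ry]; exists (u, u').
- move=> [u u'] [v v'] [[-> ->]|Ru] [[-> ->]|Rv] //=; rewrite ?i1 ?i1'//.
  + exact: E1.
  + by rewrite s1 s1'; apply: E1.
  + exact: (R1 _ _ Ru Rv).
- move=> [u u'] [v v'] [[-> ->]|Ru] [[-> ->]|Rv] //=; rewrite ?i2 ?i2'//.
  + exact: E2.
  + by rewrite s2 s2'; apply: E2.
  + exact: (R2 _ _ Ru Rv).
- by rewrite fstU; apply: (core_setU1 (a := a)).
- by rewrite sndU; apply: (core_setU1 (a := a')).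
Qed.

Lemma piso_extend B B' R (X : set T) x : ample B -> ample B' -> piso B B' R ->
  finite_set X -> bset B x -> exists Q, [/\ R `<=` Q, piso B B' Q,
    (fst @` Q) x & forall u, Q u -> R u \/ ~ X u.2].
Proof.
move=> aB aB' pR fX Bx.
have [[a a'] Ra] := piso_n0 pR; have [AB _ _ _] := piso_dom pR.
have Ba : bset B a by apply: AB; exists (a, a').
have [_ _ cB _] := aB; have [p] := cB _ _ Ba Bx.
have : (fst @` R) a by exists (a, a').
elim: p a R {a' Ra Ba AB} pR => [|b p IH] a R pR Ra /=.
  by move=> _ <-; exists R; split=> // u; left.
move=> /andP[/and3P[ab _]]; rewrite inE => Bb bp px.
have [Rb|Rb] := pselect ((fst @` R) b); first exact: (IH b).
have [y [Xy pQ]] := piso_step aB aB' pR fX Ra Bb Rb ab.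
have [|Q [RQ pQ' Qx QX]] := IH b _ pQ _ bp px; first by exists (b, y) => //; left.
exists Q; split=> // [u Ru|u /QX[[->|]|]]; first by apply: RQ; right.
- by right.
- by left.
- by right.
Qed.

Lemma piso_extend_set B B' R (X A : set T) : ample B -> ample B' ->
  piso B B' R -> finite_set X -> finite_set A -> A `<=` bset B ->
  exists Q, [/\ R `<=` Q, piso B B' Q,
    A `<=` fst @` Q & forall u, Q u -> R u \/ ~ X u.2].
Proof.
move=> aB aB' pR fX /finite_seqP[s ->]; elim: s => [|x s IH] sB.
  by exists R; split=> // u; left.
have [|Q [RQ pQ sQ QX]] := IH; first by move=> y ys; apply: sB; rewrite /= inE ys orbT.
have [|Q' [QQ' pQ' Qx QX']] := piso_extend aB aB' pQ fX (_ : bset B x).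
  by apply: sB; rewrite /= inE eqxx.
exists Q'; split=> //.
- by move=> u /RQ /QQ'.
- by move=> y /=; rewrite inE => /predU1P[->//|/sQ[u Qu <-]]; exists u => //; apply: QQ'.
- by move=> u /QX'[/QX|]; [|right].
Qed.

Lemma piso_extend2 B B' R x : ample B -> ample B' -> piso B B' R ->
  exists Q, [/\ R `<=` Q, piso B B' Q, bset B x -> (fst @` Q) x &
    bset B' x -> (snd @` Q) x].
Proof.
move=> aB aB' pR.
have [Q1 [RQ1 pQ1 Q1x]] : exists Q, [/\ R `<=` Q, piso B B' Q &
    bset B x -> (fst @` Q) x].
  have [Bx|Bx] := pselect (bset B x); last by exists R; split.
  have [Q [RQ pQ Qx _]] := piso_extend aB aB' pR (finite_set0 T) Bx.
  by exists Q.
have [Bx|Bx] := pselect (bset B' x); last by exists Q1; split.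
have [Q [RQ pQ Qx _]] := piso_extend aB' aB (piso_swap pQ1) (finite_set0 T) Bx.
have Q1Q : Q1 `<=` swap Q by move=> -[a b] Qab; apply: RQ.
exists (swap Q); split; rewrite ?snd_swap//.
- by apply: subset_trans RQ1 Q1Q.
- exact: piso_swap.
- by move=> /Q1x[u Qu <-]; exists u => //; apply: Q1Q.
Qed.

Lemma back_and_forth B B' R : ample B -> ample B' -> piso B B' R ->
  exists U : set (T * T), [/\ R `<=` U,
    forall x, bset B x -> exists y, U (x, y),
    forall y, bset B' y -> exists x, U (x, y),
    forall u, U u -> bset B u.1 /\ bset B' u.2 &
    forall u v, U u -> U v -> [/\ u.1 = v.1 <-> u.2 = v.2,
      brel1 B u.1 v.1 = brel1 B' u.2 v.2 & brel2 B u.1 v.1 = brel2 B' u.2 v.2]].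
Proof.
move=> aB aB' pR; have [f fP] := omega_enum T.
(* Stage [n] puts [f n] into both the domain and the range, wherever it belongs to the graph; [F] is
   made total so that it can be iterated. *)
have /choice[F FP] : forall Rn : set (T * T) * nat, exists Q, piso B B' Rn.1 ->
    [/\ Rn.1 `<=` Q, piso B B' Q, bset B (f Rn.2) -> (fst @` Q) (f Rn.2) &
      bset B' (f Rn.2) -> (snd @` Q) (f Rn.2)].
  move=> [Q n] /=; have [pQ|pQ] := pselect (piso B B' Q); last by exists Q.
  by have [Q' ?] := piso_extend2 (f n) aB aB' pQ; exists Q'.
pose fix G n := if n is m.+1 then F (G m, m) else R.
have pG n : piso B B' (G n) by elim: n => //= n IH; have [] := FP (G n, n) IH.
have GS n : G n `<=` G n.+1 by have [] := FP (G n, n) (pG n).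
have Gle m n : m <= n -> G m `<=` G n.
  elim: n => [|n IH]; first by rewrite leqn0 => /eqP->.
  by rewrite leq_eqVlt => /predU1P[->//|/IH H] u /H /GS.
exists (\bigcup_n G n); split.
- by move=> u Ru; exists 0.
- move=> x Bx; have [n fn] := fP x; have [_ _ /= + _] := FP (G n, n) (pG n).
  by rewrite fn => /(_ Bx)[[a b] Gab /= <-]; exists b, n.+1.
- move=> x Bx; have [n fn] := fP x; have [_ _ _ /=] := FP (G n, n) (pG n).
  by rewrite fn => /(_ Bx)[[a b] Gab /= <-]; exists a, n.+1.
- move=> u [n _ Gu]; have [+ _ _ _] := piso_dom (pG n).
  have [+ _ _ _] := piso_ran (pG n).
  by move=> H1 H2; split; [apply: H2|apply: H1]; exists u.
move=> u v [m _ Gu] [n _ Gv].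
have {}Gu := Gle _ _ (leq_maxl m n) _ Gu; have {}Gv := Gle _ _ (leq_maxr m n) _ Gv.
have [_ _ Ri R1 R2 _ _] := pG (maxn m n).
by split; [exact: Ri|exact: R1|exact: R2].
Qed.

End BackAndForth.

(** * Spheromorphisms *)

Section Spheromorphisms.
Variable T : omega_tree.
Implicit Types (e : rel T) (g h : vperm T) (A B S J : set T) (F : set (set T)).

Definition pull g : rel T := [rel x y | adj (g x) (g y)].

Definition common g : rel T := [rel x y | adj x y && adj (g x) (g y)].

Definition bad g : set (T * T) :=
  [set u | adj u.1 u.2 <> adj (g u.1) (g u.2)].

Lemma infinite_nbrs x : infinite_set [set y : T | adj x y].
Proof. by apply/infiniteP; have := adj_valence x; rewrite card_eq_le => /andP[]. Qed.

Lemma reach_pull e g x y :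
  reach e (g x) (g y) <-> reach [rel a b | e (g a) (g b)] x y.
Proof.
split=> -[p ep pl].
  exists (map (vinv g) p).
    rewrite -[x](vfunK g) path_map; apply: sub_path ep => a b /=.
    by rewrite !vinvK.
  by rewrite -[x](vfunK g) last_map pl vfunK.
exists (map g p); first by rewrite path_map.
by rewrite last_map pl.
Qed.

Lemma pull_forest g : forest_rel (pull g).
Proof.
have [s i c] := adj_forest T; split=> [x y|x|p /andP[ep up]].
- exact: s.
- exact: i.
rewrite -(size_map g); apply: c; rewrite /ucycle map_inj_uniq ?up; last first.
  exact: can_inj (@vfunK _ g).
by case: p ep {up} => //= x p ep; rewrite -map_rcons path_map ep.
Qed.

Lemma pull_reach g x y : reach (pull g) x y.
Proof. exact/reach_pull/adj_connected. Qed.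

(** In the forest [e'] the only simple path between adjacent vertices is the edge itself, so the
    path in [e] consists of that edge. *)
Lemma forest_reach_edge e e' x y : forest_rel e' -> subrel e e' ->
  reach e x y -> e' x y -> e x y.
Proof.
move=> fe ee /reach_uniq[p [ep pl up]] exy; have [_ ie _] := fe.
have xy : x != y by apply/eqP => xy; rewrite xy ie in exy.
have ep' : path e' x p by apply: sub_path ep.
have pE : p = [:: y].
  by apply: (uniq_path_eq fe ep'); rewrite //= ?exy// mem_seq1 xy.
by move: ep; rewrite pE /= andbT.
Qed.

Lemma common_sym g : symmetric (common g).
Proof. by move=> x y; rewrite /common /= adj_sym [adj (g y) _]adj_sym. Qed.

(** Follow the [e']-path up to its first edge missing from [e]. Used to show that every component of
    [e] contains a marked vertex. *)
Lemma exit_edge e e' (P : T -> Prop) x y : reach e' x y -> P y ->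
  (forall a b, e' a b -> ~~ e a b -> P a) -> exists2 z, reach e x z & P z.
Proof.
move=> [p]; elim: p x => [|z p IH] x /=.
  by move=> _ -> Py _; exists y => //; apply: reach_refl.
move=> /andP[xz zp] pl Py Pe; have [exz|exz] := boolP (e x z).
  have [w zw Pw] := IH z zp pl Py Pe.
  by exists w => //; apply: reach_trans zw; apply: reach1.
by exists x; [apply: reach_refl|apply: Pe exz].
Qed.

Lemma class_eq e x y : symmetric e -> reach e x y ->
  [set z | reach e x z] = [set z | reach e y z].
Proof.
move=> es xy; apply/seteqP; split=> z /=; apply: reach_trans => //.
exact: reach_sym.
Qed.

Lemma class_conn e e' x : symmetric e -> subrel e e' ->
  conn e' [set y | reach e x y].
Proof.
move=> es ee y z /= xy xz.
have [p] : reach e y z by apply: reach_trans xz; apply: reach_sym.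
elim: p y xy => [|w p IH] y xy /=; first by move=> _ ->; apply: reach_refl.
move=> /andP[yw wp] pz; have xw : reach e x w by apply: reach_trans xy (reach1 yw).
by apply: reach_trans (IH w xw wp pz); apply: restr1 => //; apply: ee.
Qed.

(** Back-and-forth between [T] and [S] with both relations equal to [adj]: the agreement condition
    is then void, and a single pair is a starting point. *)
Lemma is_Tsubtree_ample S : S !=set0 -> conn (@adj T) S ->
  (forall x, S x -> infinite_set [set y | S y /\ adj x y]) ->
  finite_set [set u : T * T | [/\ adj u.1 u.2, S u.1 & ~ S u.2]] ->
  is_Tsubtree S.
Proof.
move=> [x0 Sx0] Sc Si fS; split=> //; first by split=> //; exists x0.
have af := adj_forest T.
pose B := Bigraph [set: T] (@adj T) (@adj T).
pose B' := Bigraph S (@adj T) (@adj T).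
have aB : ample B.
  split=> //= [x y _ _|x _].
    apply: reach_sub (adj_connected x y) => a b ab.
    by apply/and3P; rewrite !inE.
  have -> : [set y | [/\ True, adj x y & adj x y]] = [set y | adj x y].
    by apply/seteqP; split=> y /= => [[]|].
  exact: infinite_nbrs.
have aB' : ample B'.
  split=> //= x Sx; apply: sub_infinite_set (Si x Sx) => y [Sy xy].
  by split.
have pR : piso B B' [set (x0, x0)].
  have c1 : conn (@adj T) [set x0] by move=> x y -> ->; apply: reach_refl.
  split=> //=.
  - by exists (x0, x0).
  - by move=> u v -> ->.
  - by move=> u v -> ->.
  - by move=> u v -> ->.
  - by rewrite image_set1; split.
  - by rewrite image_set1; split=> // x ->.
have [U [_ Ud Ur US Ui]] := back_and_forth aB aB' pR.
have /choice[f fP] : forall x, exists y, U (x, y) by move=> x; apply: Ud.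
exists f; split.
- by move=> x y fxy; have [[_ +] _ _] := Ui _ _ (fP x) (fP y); apply.
- apply/seteqP; split=> [_ [x _ <-]|y Sy]; first by have [] := US _ (fP x).
  have [x Uxy] := Ur y Sy; exists x => //.
  by have [[/(_ erefl) /= -> _] _ _] := Ui _ _ Uxy (fP x).
- by move=> x y; have [_ /= -> _] := Ui _ _ (fP x) (fP y).
Qed.

Definition cut e : set (T * T) := [set u | adj u.1 u.2 && ~~ e u.1 u.2].

(** Every component contains the base point or an end of a cut edge, so there are finitely many;
    infinite valence survives the loss of finitely many edges. *)
Lemma cut_covering e : symmetric e -> subrel e (@adj T) -> finite_set (cut e) ->
  covering_forest (components e).
Proof.
move=> es ea fe; have [x0] := vert_inhabited T.
have as_ := @adj_sym T.
split.
- apply: (@sub_finite_set _ _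
    ((fun x => [set y | reach e x y]) @` (x0 |` fst @` cut e))).
    move=> _ [x _ <-].
    have [||z xz Pz] := exit_edge (P := fun z => (x0 |` fst @` cut e) z)
      (e := e) (adj_connected x x0).
    + by left.
    + by move=> a b ab eab; right; exists (a, b) => //=; rewrite /cut /= ab.
    by exists z => //; rewrite (class_eq es xz).
  apply: finite_image; rewrite finite_setU; split; first exact: finite_set1.
  exact: finite_image.
- move=> _ [x _ <-]; apply: is_Tsubtree_ample.
  + by exists x; apply: reach_refl.
  + exact: class_conn.
  + move=> y /= xy.
    have := infinite_setD (infinite_nbrs (x := y)) (finite_image snd fe).
    apply: sub_infinite_set.
    move=> z [/= yz nz]; split=> //; apply: reach_trans xy (reach1 _).
    by apply: contra_notT nz => eyz; exists (y, z) => //=; rewrite /cut /= yz.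
  + apply: sub_finite_set fe => -[a b] [/= ab xa xb]; rewrite /cut /= ab /=.
    by apply/negP => eab; apply: xb; apply: reach_trans xa (reach1 eab).
- move=> _ _ [x _ <-] [y _ <-] [z [/= xz yz]].
  by rewrite (class_eq es xz) (class_eq es yz).
- exists (cut e) => //; congr components; apply/funext => a; apply/funext => b.
  rewrite /forest_edge /=; apply/idP/idP => [eab|].
    rewrite ea//=; apply/and3P; split.
    + by apply/asboolP; exists setT.
    + by apply/negP; rewrite inE /cut /= eab andbF.
    + by apply/negP; rewrite inE /cut /= es eab andbF.
  move=> /and3P[/andP[ab _] + _]; apply: contraNT => eab.
  by rewrite inE /cut /= ab.
Qed.

End Spheromorphisms.

(** * Spheromorphisms as permutations with finitely many bad pairs *)

Section HierGroup.
Variable T : omega_tree.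
Implicit Types (e : rel T) (g h k : vperm T) (A B S J : set T) (F : set (set T)).

Lemma covering_edge F : covering_forest F -> exists2 E : set (T * T),
  finite_set E & forall a b, adj a b -> ~ E (a, b) -> exists S, [/\ F S, S a & S b].
Proof.
case=> _ _ _ [E fE FE]; exists (E `|` (fun u => (u.2, u.1)) @` E).
  by rewrite finite_setU; split=> //; apply: finite_image.
move=> a b ab /not_orP[E1 E2]; rewrite FE.
have ab' : [rel a b | [&& forest_edge [set [set: T]] a b, (a, b) \notin E &
    (b, a) \notin E]] a b.
  apply/and3P; split.
  - by rewrite /forest_edge /= ab; apply/asboolP; exists setT.
  - by apply/negP; rewrite inE.
  - by apply/negP; rewrite inE => Eba; apply: E2; exists (b, a).
eexists; split; [by exists a|exact: reach_refl|exact: reach1].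
Qed.

Definition conj_rel e g : rel T := [rel u v | e (vinv g u) (vinv g v)].

Lemma image_components e g :
  image_forest g (components e) = components (conj_rel e g).
Proof.
have E x : g @` [set y | reach e x y] = [set v | reach (conj_rel e g) (g x) v].
  apply/seteqP; split=> [_ [y /= xy <-]|v /= xv].
    apply/reach_pull; apply: reach_sub xy => a b.
    by rewrite /conj_rel /= !vfunK.
  exists (vinv g v); last by rewrite vinvK.
  move: xv; rewrite /= -{1}[v](vinvK g) => /reach_pull.
  by apply: reach_sub => a b; rewrite /conj_rel /= !vfunK.
apply/seteqP; split=> [_ [_ [x _ <-] <-]|_ [v _ <-]].
  by rewrite E; exists (g x).
by exists [set y | reach e (vinv g v) y]; [exists (vinv g v)|rewrite E vinvK].
Qed.

Lemma common_embeds g x : embeds_on g [set y | reach (common g) x y].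
Proof.
have s := @common_sym T g.
move=> y z /= xy xz; have yz : reach (common g) y z.
  by apply: reach_trans xz; apply: reach_sym.
have c1 : subrel (common g) (@adj T) by move=> ? ? /andP[].
have c2 : subrel (common g) (pull g) by move=> ? ? /andP[].
apply/idP/idP => [e2|e1].
  by have /andP[] := forest_reach_edge (pull_forest g) c2 yz e2.
by have /andP[] := forest_reach_edge (adj_forest T) c1 yz e1.
Qed.

Lemma finite_bad_inv g : finite_set (bad g) ->
  finite_set [set u | adj u.1 u.2 <> adj (vinv g u.1) (vinv g u.2)].
Proof.
move=> /(finite_image (fun u => (g u.1, g u.2))); apply: sub_finite_set.
move=> [a b] /= ab; exists (vinv g a, vinv g b); rewrite /bad /= !vinvK//.
exact/nesym.
Qed.

Lemma covering_common g : finite_set (bad g) ->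
  covering_forest (components (common g)).
Proof.
move=> fg; apply: cut_covering; [exact: common_sym|by move=> ? ? /andP[]|].
apply: sub_finite_set fg => -[a b]; rewrite /cut /common /bad /= => /andP[->].
by move=> /= /negPf ->.
Qed.

Lemma HierP g : Hier g <-> finite_set (bad g).
Proof.
split=> [[F [cF cgF Fe]]|fg]; last first.
  exists (components (common g)); split.
  - exact: covering_common.
  - rewrite image_components; apply: cut_covering.
    + by move=> u v; apply: common_sym.
    + by move=> u v /andP[_]; rewrite !vinvK.
    apply: sub_finite_set (finite_bad_inv fg) => -[a b].
    rewrite /cut /conj_rel /common /= !vinvK => /andP[->].
    by rewrite andbT => /negPf ->.
  - by move=> _ [x _ <-]; apply: common_embeds.
have [E fE EP] := covering_edge cF; have [E' fE' EP'] := covering_edge cgF.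
(* A bad pair is either an edge removed from the source, or the preimage of an edge removed from the
   target: an edge left in place lies in a tree on which [g] is an embedding. *)
apply: (@sub_finite_set _ _ (E `|` (fun u => (vinv g u.1, vinv g u.2)) @` E')).
  move=> [a b]; rewrite /bad /= => nab.
  have [ab|ab] := boolP (adj a b).
    left; apply: contra_notP nab => /(EP _ _ ab)[S [FS Sa Sb]].
    by rewrite (Fe S).
  have [gab|gab] := boolP (adj (g a) (g b)); last first.
    by move: nab; rewrite (negPf ab) (negPf gab).
  right; exists (g a, g b); rewrite /= ?vfunK//.
  apply: contra_notP nab => /(EP' _ _ gab)[_ [[S FS <-] [a' Sa gaa] [b' Sb gbb]]].
  have ga := can_inj (@vfunK _ g).
  by rewrite (Fe S)// -?(ga _ _ gaa) -?(ga _ _ gbb).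
by rewrite finite_setU; split=> //; apply: finite_image.
Qed.

Lemma AutT_Hier k : AutT k -> Hier k.
Proof.
move=> kA; apply/HierP; suff -> : bad k = set0 by exact: finite_set0.
by apply/seteqP; split=> // -[a b]; rewrite /bad /= kA.
Qed.

Lemma HierM g h : Hier g -> Hier h -> Hier (g * h)%g.
Proof.
move=> /HierP fg /HierP fh; apply/HierP.
apply: (@sub_finite_set _ _
    (bad h `|` (fun u => (vinv h u.1, vinv h u.2)) @` bad g)).
  move=> [a b]; rewrite /bad /= => ab.
  have [hab|hab] := eqVneq (adj a b) (adj (h a) (h b)); last by left; apply/eqP.
  right; exists (h a, h b); rewrite /= ?vfunK//.
  by rewrite -hab.
by rewrite finite_setU; split=> //; apply: finite_image.
Qed.

Lemma HierV g : Hier g -> Hier (g^-1)%g.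
Proof. by move=> /HierP /finite_bad_inv fg; apply/HierP. Qed.

Lemma Hier1 : Hier (1%g : vperm T).
Proof. by apply: AutT_Hier => x y. Qed.

Lemma K_AutT J k : K J k -> AutT k.
Proof. by case. Qed.

Lemma K_Hier J k : K J k -> Hier k.
Proof. by move=> /K_AutT; apply: AutT_Hier. Qed.

Lemma K1 J : K J 1%g.
Proof. by split. Qed.

Lemma KM J k h : K J k -> K J h -> K J (k * h)%g.
Proof.
move=> [ka kJ] [ha hJ]; split=> x; first by move=> y; rewrite /= ka ha.
by move=> Jx; rewrite /= hJ// kJ.
Qed.

Lemma KV J k : K J k -> K J (k^-1)%g.
Proof.
move=> [ka kJ]; split=> x; first by move=> y; rewrite /= -ka !vinvK.
by move=> Jx /=; rewrite -{1}(kJ _ Jx) vfunK.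
Qed.

Lemma KS A B k : A `<=` B -> K B k -> K A k.
Proof. by move=> AB [ka kB]; split=> // x /AB /kB. Qed.

(** * The perfect forest *)

Lemma forest_edge_common g a b :
  forest_edge (components (common g)) a b = common g a b.
Proof.
apply/idP/idP => [/andP[ab /asboolP[_ [[x _ <-] /= xa xb]]]|ab].
  have c1 : subrel (common g) (@adj T) by move=> ? ? /andP[].
  apply: (forest_reach_edge (adj_forest T) c1) => //.
  by apply: reach_trans xb; apply: reach_sym xa; apply: common_sym.
apply/andP; split; first by case/andP: ab.
apply/asboolP; exists [set y | reach (common g) a y]; split.
- by exists a.
- exact: reach_refl.
- exact: reach1.
Qed.

Lemma components_eq e e' : (forall x y, reach e x y <-> reach e' x y) ->
  components e = components e'.
Proof.
move=> ee; rewrite /components; congr (_ @` _); apply/funext => x.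
by apply/seteqP; split=> y /= /ee.
Qed.

Lemma compatible_edge g F a b : compatible g F -> forest_edge F a b ->
  common g a b.
Proof.
move=> [_ Fe] /andP[ab /asboolP[S [FS Sa Sb]]].
by rewrite /common /= (Fe S)// ab.
Qed.

Lemma removed_sym F (E : set (T * T)) : symmetric
  [rel a b | [&& forest_edge F a b, (a, b) \notin E & (b, a) \notin E]].
Proof.
move=> a b; rewrite /forest_edge /= adj_sym; congr (_ && _); last exact: andbC.
by congr (_ && _); apply: asbool_equiv_eq; split=> -[S [? ? ?]]; exists S.
Qed.

(** Edges inside the trees of a compatible forest [F'] are common edges. Hence the set [E] whose
    removal from [T] gives [F'] also gives [F'] when removed from the forest of common edges. *)
Lemma is_perfect_common g : Hier g -> is_perfect g (components (common g)).
Proof.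
move=> /HierP fg; split.
  by split; [exact: covering_common|move=> _ [x _ <-]; apply: common_embeds].
move=> F' cF'; have [[_ _ _ [E fE FE]] _] := cF'.
exists E => //; rewrite {1}FE; apply: components_eq => x y.
have all_edge a b : adj a b -> forest_edge [set [set: T]] a b.
  by move=> ab; apply/andP; split=> //; apply/asboolP; exists setT.
split; apply: reach_sub => a b /and3P[ab nE nE']; apply/and3P; split=> //.
  have abj : adj a b by case/andP: ab.
  rewrite forest_edge_common; apply: (compatible_edge cF'); rewrite /forest_edge /= abj.
  apply/asboolP; exists [set y | reach [rel a b |
    [&& forest_edge [set [set: T]] a b, (a, b) \notin E & (b, a) \notin E]] a y].
  split; [by rewrite FE; exists a|exact: reach_refl|apply: reach1; exact/and3P].
by apply: all_edge; case/andP: ab.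
Qed.

(* A perfect forest and the forest of [common g] are each finer than the other. *)
Lemma perfect_forestE g : Hier g -> perfect_forest g = components (common g).
Proof.
move=> Hg; have pc := is_perfect_common Hg.
apply: xget_unique => // F [cF Fp].
have [[_ _ _ [E fE FE]] Fe] := cF.
have [E' _ CE'] := Fp _ pc.1.
have sub1 : subrel (forest_edge F) (common g).
  by move=> a b; apply: compatible_edge.
pose r := [rel a b | [&& forest_edge F a b, (a, b) \notin E' & (b, a) \notin E']].
have rE x y : reach (common g) x y -> reach r x y.
  move=> xy; have : components r [set z | reach (common g) x z].
    by rewrite -[components r]/(remove_edges F E') -CE'; exists x.
  case=> w _ wE; have : [set z | reach r w z] x by rewrite wE; apply: reach_refl.
  have : [set z | reach r w z] y by rewrite wE.
  move=> /= wy wx; apply: reach_trans wy; apply: reach_sym wx.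
  exact: removed_sym.
pose s := [rel a b | [&& forest_edge [set [set: T]] a b, (a, b) \notin E &
    (b, a) \notin E]].
have FE' : F = components s by rewrite FE.
rewrite FE'; apply: components_eq => x y; split.
  apply: reach_sub => a b ab; apply: sub1.
  case/and3P: (ab) => /andP[abj _] _ _; rewrite /forest_edge /= abj.
  apply/asboolP; exists [set y | reach s a y]; split.
  - by rewrite FE'; exists a.
  - exact: reach_refl.
  - exact: reach1.
move=> /rE xy; apply: (@reach_ind _ r (fun y => reach s x y)) xy.
  move=> a b /and3P[/andP[ab /asboolP[S [FS Sa Sb]]] _ _] xa.
  move: FS Sa Sb; rewrite FE' => -[w _ <-] /= wa wb.
  apply: reach_trans xa _; apply: reach_trans wb; apply: reach_sym wa.
  exact: removed_sym.
exact: reach_refl.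
Qed.

End HierGroup.

(** * The bi-tree of a spheromorphism *)

Section BitreeCore.
Variable T : omega_tree.
Implicit Types (e : rel T) (g h k : vperm T) (A B I J S : set T).

Lemma conn_preimage e g A : conn e A ->
  conn [rel a b | e (g a) (g b)] (g @^-1` A).
Proof.
move=> Ac x y Ax Ay; have /reach_pull := Ac _ _ Ax Ay.
by apply: reach_sub => a b /and3P[ab]; rewrite !inE => Aa Ab; apply/and3P; rewrite !inE.
Qed.

Lemma conn_image g A : conn (pull g) A -> conn (@adj T) (vinv g @^-1` A).
Proof.
move=> Ac x y Ax Ay; rewrite -[x](vinvK g) -[y](vinvK g); apply/reach_pull.
apply: reach_sub (Ac _ _ Ax Ay) => a b /and3P[ab]; rewrite !inE => Aa Ab.
by apply/and3P; rewrite !inE /= !vfunK.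
Qed.

Lemma sub_hull A : A `<=` hull A.
Proof. exact: sub_gen_smallest. Qed.

Lemma hull_min A B : is_subtree B -> A `<=` B -> hull A `<=` B.
Proof. exact: smallest_sub. Qed.

Lemma conn_hull A : conn (@adj T) (hull A).
Proof.
apply: convex_conn; first exact: adj_connected.
move=> x p ep up Ax Al z zp B [[Bn0 Bc] AB].
apply: (conn_convex (adj_forest T) Bc ep up) zp; first by apply: Ax.
by apply: Al.
Qed.

Definition marks g I J : set T :=
  [set x | [\/ I x, J (g x) | exists y, adj x y <> adj (g x) (g y)]].

(* The vertex set of the (I, J)-bi-tree of [g], see [bitree_cset]. *)
Definition bicore g I J : set T :=
  smallest [set A | convex (@adj T) A /\ convex (pull g) A] (marks g I J).

Lemma sub_bicore g I J : marks g I J `<=` bicore g I J.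
Proof. exact: sub_gen_smallest. Qed.

Lemma bicore_conn1 g I J : conn (@adj T) (bicore g I J).
Proof.
apply: convex_conn; first exact: adj_connected.
move=> x p ep up Ax Al z zp B [[c1 c2] AB].
by apply: (c1 _ _ ep up) zp; [apply: Ax|apply: Al].
Qed.

Lemma bicore_conn2 g I J : conn (pull g) (bicore g I J).
Proof.
apply: convex_conn; first exact: pull_reach.
move=> x p ep up Ax Al z zp B [[c1 c2] AB].
by apply: (c2 _ _ ep up) zp; [apply: Ax|apply: Al].
Qed.

Lemma bicore_min g I J A : conn (@adj T) A -> conn (pull g) A ->
  marks g I J `<=` A -> bicore g I J `<=` A.
Proof.
move=> c1 c2; apply: smallest_sub; split.
  exact: conn_convex (adj_forest T) c1.
exact: conn_convex (pull_forest g) c2.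
Qed.

Lemma bicore_agree g I J x y : ~ (bicore g I J x /\ bicore g I J y) ->
  adj x y = pull g x y.
Proof.
move=> nC; apply: contrapT => nxy; apply: nC; split; apply: sub_bicore.
  by apply: Or33; exists y.
by apply: Or33; exists x; rewrite adj_sym [adj (g y) _]adj_sym.
Qed.

Lemma finite_marks g I J : Hier g -> finite_set I -> finite_set J ->
  finite_set (marks g I J).
Proof.
move=> /HierP fg fI fJ; apply: (@sub_finite_set _ _
    (I `|` (vinv g @` J `|` fst @` bad g))).
  move=> x [Ix|Jx|[y xy]]; first by left.
    by right; left; exists (g x); rewrite ?vfunK.
  by right; right; exists (x, y).
by rewrite !finite_setU; split=> //; split; apply: finite_image.
Qed.

(** One closure under each tree is enough. Close the marks to [A], connected for [adj], then [A] to
    [B], connected for [pull g]. The relations agree off [A], so by [conn_agree] the set [B] is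
    connected for [adj] too. *)
Lemma finite_bicore g I J : Hier g -> finite_set I -> finite_set J ->
  I !=set0 -> finite_set (bicore g I J).
Proof.
move=> Hg fI fJ [i Ii]; have [s1 _ _] := adj_forest T.
have [s2 _ _] := pull_forest g.
have Mi : marks g I J i by apply: Or31.
have [A [fA MA Ac]] := finite_conn_hull (@adj_connected T) s1
  (finite_marks Hg fI fJ) Mi.
have [B [fB AB Bc]] := finite_conn_hull (@pull_reach T g) s2 fA (MA _ Mi).
apply: sub_finite_set fB; apply: bicore_min => //; last exact: subset_trans AB.
apply: (conn_agree s1 _ Ac AB Bc); first by exists i; apply: MA.
move=> x y nA; apply: contrapT => nxy; apply: nA; split; apply: MA.
  by apply: Or33; exists y.
by apply: Or33; exists x; rewrite adj_sym [adj (g y) _]adj_sym.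
Qed.

Definition bigraph_of g : bigraph T := Bigraph [set: T] (@adj T) (pull g).

Lemma ample_bigraph_of g : Hier g -> ample (bigraph_of g).
Proof.
move=> /HierP fg; split=> /=; [exact: adj_forest|exact: pull_forest| |].
  move=> x y _ _; apply: reach_sub (adj_connected x y) => a b ab.
  by apply/and3P; rewrite !inE.
move=> x _; have := infinite_setD (@infinite_nbrs T x) (finite_image snd fg).
apply: sub_infinite_set => y [/= xy nb]; split=> //.
apply: contra_notT nb => gxy; exists (x, y) => //; rewrite /bad /= xy => E.
by rewrite /pull /= -E in gxy.
Qed.

Lemma core_bicore g I J : core (bigraph_of g) (bicore g I J).
Proof.
split=> //=; [exact: bicore_conn1|exact: bicore_conn2|].
by move=> x y _ _; apply: bicore_agree.
Qed.

Definition edge_color (b1 b2 : bool) : option color :=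
  match b1, b2 with
  | true, true => Some Black
  | true, false => Some Blue
  | false, true => Some Red
  | false, false => None
  end.

Lemma blue_edgeE g x y : Hier g ->
  blue_edge g x y = adj x y && ~~ adj (g x) (g y).
Proof.
move=> Hg; rewrite /blue_edge /= perfect_forestE// forest_edge_common /common /=.
by case: (adj x y).
Qed.

Lemma red_edgeE g u v : Hier g ->
  red_edge g u v = adj u v && ~~ adj (vinv g u) (vinv g v).
Proof.
move=> Hg; rewrite /red_edge /= perfect_forestE// image_components.
have -> : components (conj_rel (common g) g) = components (common g^-1%g).
  by apply: components_eq => x y; split; apply: reach_sub => a b;
    rewrite /conj_rel /common /= !vinvK andbC.
by rewrite forest_edge_common /common /=; case: (adj u v).
Qed.

(** Every tree of the perfect forest contains a vertex of [I] or an end of a blue edge, hence meets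
    [skelI]. So the sets spanning the [Xi] are nonempty, as subtrees are required to be. *)
Lemma near_mark1 g I x : Hier g -> I !=set0 ->
  exists2 z, reach (common g) x z & I z \/ exists y, blue_edge g z y.
Proof.
move=> Hg [i Ii].
apply: (exit_edge (P := fun z => I z \/ exists y, blue_edge g z y)
  (adj_connected x i)); first by left.
move=> a b ab; rewrite /common /= ab /= => nab.
by right; exists b; rewrite blue_edgeE// ab.
Qed.

Lemma near_mark2 g J x : Hier g -> J !=set0 ->
  exists2 z, reach (common g) x z & J (g z) \/ exists y, red_edge g (g z) y.
Proof.
move=> Hg [j Jj].
apply: (exit_edge (P := fun z => J (g z) \/ exists y, red_edge g (g z) y)
  (pull_reach g x (vinv g j))); first by left; rewrite vinvK.
move=> a b ab; rewrite /common /=; rewrite /pull /= in ab.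
rewrite ab andbT => nab; right; exists (g b).
by rewrite red_edgeE// ab !vfunK.
Qed.

Lemma sub_skelI g I : I `|` [set x | exists y, blue_edge g x y] `<=` skelI g I.
Proof. exact: sub_hull. Qed.

Lemma sub_skelJ g J : J `|` [set x | exists y, red_edge g x y] `<=` skelJ g J.
Proof. exact: sub_hull. Qed.

Lemma skelI_meets g I x : Hier g -> I !=set0 ->
  exists2 z, reach (common g) x z & skelI g I z.
Proof.
move=> Hg I0; have [z xz zI] := near_mark1 x Hg I0.
by exists z => //; apply: sub_skelI; case: zI; [left|right].
Qed.

Lemma skelJ_meets g J x : Hier g -> J !=set0 ->
  exists2 z, reach (common g) x z & skelJ g J (g z).
Proof.
move=> Hg J0; have [z xz zJ] := near_mark2 x Hg J0.
by exists z => //; apply: sub_skelJ; case: zJ; [left|right].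
Qed.

Lemma skelI_sub g I J : Hier g -> I !=set0 -> skelI g I `<=` bicore g I J.
Proof.
move=> Hg [i Ii]; apply: hull_min => [|x [Ix|[y]]].
- by split; [exists i; apply: sub_bicore; apply: Or31|exact: bicore_conn1].
- by apply: sub_bicore; apply: Or31.
- rewrite blue_edgeE// => /andP[xy gxy]; apply: sub_bicore; apply: Or33; exists y.
  by rewrite xy (negPf gxy).
Qed.

Lemma skelJ_sub g I J : Hier g -> J !=set0 ->
  skelJ g J `<=` vinv g @^-1` bicore g I J.
Proof.
move=> Hg [j Jj]; apply: hull_min => [|x [Jx|[y]]].
- split; last by apply: conn_image; apply: bicore_conn2.
  by exists j; apply: sub_bicore; apply: Or32; rewrite vinvK.
- by apply: sub_bicore; apply: Or32; rewrite vinvK.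
- rewrite red_edgeE// => /andP[xy gxy]; apply: sub_bicore; apply: Or33.
  by exists (vinv g y); rewrite !vinvK xy (negPf gxy).
Qed.

Lemma Xi_sub g I J x : Hier g -> I !=set0 -> J !=set0 ->
  Xi g I J [set y | reach (common g) x y] `<=`
  bicore g I J `&` [set y | reach (common g) x y].
Proof.
move=> Hg I0 J0; have gi := can_inj (@vfunK _ g).
apply: hull_min => [|y [[xy /(skelI_sub (J := J) Hg I0) //]|[[z xz /gi <-]]]].
- split.
    have [z xz zI] := skelI_meets x Hg I0.
    by exists z; split=> //; apply: (skelI_sub (J := J) Hg I0).
  apply: convex_conn; first exact: adj_connected.
  apply: convexI; apply: (conn_convex (adj_forest T)); first exact: bicore_conn1.
  by apply: class_conn; [exact: common_sym|move=> ? ? /andP[]].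
- by move=> /(skelJ_sub (I := I) Hg J0); rewrite /= vfunK.
Qed.

(** The union of the [Xi] is connected for [adj] because each piece is attached to the connected set
    [skelI], and for [pull g] because each is attached to the preimage of [skelJ]; minimality of
    [bicore] gives one inclusion. For the other, each [Xi] is a hull inside the convex set cut out
    of [bicore] by a tree of the forest. *)
Lemma bitree_cset g I J : Hier g -> I !=set0 -> J !=set0 ->
  cset (bitree g I J) = bicore g I J.
Proof.
move=> Hg I0 J0; have [s1 _ _] := adj_forest T; have [s2 _ _] := pull_forest g.
rewrite /= perfect_forestE//; pose cl x := [set y | reach (common g) x y].
have sub1 x z : reach (common g) x z -> skelI g I z -> Xi g I J (cl x) z.
  by move=> xz zI; apply: sub_hull; left.
have sub2 x z : reach (common g) x z -> skelJ g J (g z) -> Xi g I J (cl x) z.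
  by move=> xz zJ; apply: sub_hull; right; split=> //; exists z.
apply/seteqP; split=> [y [_ [x _ <-] /(Xi_sub Hg I0 J0)[]]//|].
have XiS x : Xi g I J (cl x) `<=` \bigcup_(S in components (common g)) Xi g I J S.
  by move=> y ?; exists (cl x) => //; exists x.
apply: bicore_min.
- apply: (@conn_star _ _ (skelI g I)) => //; first exact: conn_hull.
    by move=> x xI; apply: (XiS x); apply: sub1 => //; apply: reach_refl.
  move=> b [_ [x _ <-] xb]; have [z xz zI] := skelI_meets x Hg I0; exists z => //.
  apply: reach_sub (conn_hull xb (sub1 _ _ xz zI)); exact: restrS (XiS x).
- apply: (@conn_star _ _ (g @^-1` skelJ g J)) => //.
  + exact/conn_preimage/conn_hull.
  + by move=> x xJ; apply: (XiS x); apply: sub2 => //; apply: reach_refl.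
  move=> b [_ [x _ <-] xb]; have [z xz zJ] := skelJ_meets x Hg J0; exists z => //.
  apply: reach_sub (conn_hull xb (sub2 _ _ xz zJ)) => u v /and3P[uv].
  rewrite !inE => Xu Xv; apply/and3P; rewrite !inE; split; last 2 first.
  + exact: XiS Xu.
  + exact: XiS Xv.
  have [_ xu] := Xi_sub Hg I0 J0 Xu; have [_ xv] := Xi_sub Hg I0 J0 Xv.
  by rewrite /pull /= (common_embeds xu xv).
move=> x mx; apply: (XiS x); case: mx => [Ix|Jx|[y xy]].
- by apply: sub1; [exact: reach_refl|apply: sub_skelI; left].
- by apply: sub2; [exact: reach_refl|apply: sub_skelJ; left].
have [e1|e1] := boolP (adj x y).
  apply: sub1; [exact: reach_refl|apply: sub_skelI; right; exists y].
  by rewrite blue_edgeE// e1; apply/negP => e2; rewrite e1 e2 in xy.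
apply: sub2; [exact: reach_refl|apply: sub_skelJ; right; exists (g y)].
rewrite red_edgeE// !vfunK e1 andbT; apply: contra_notT xy => e2.
by rewrite (negPf e1) (negPf e2).
Qed.

Lemma bitree_ccol g I J x y : Hier g -> I !=set0 -> J !=set0 ->
  bicore g I J x -> bicore g I J y ->
  ccol (bitree g I J) x y = edge_color (adj x y) (adj (g x) (g y)).
Proof.
move=> Hg I0 J0; rewrite -bitree_cset// => Cx Cy /=.
rewrite blue_edgeE// red_edgeE// !vfunK.
suff -> : `[< exists S, [/\ perfect_forest g S, Xi g I J S x, Xi g I J S y &
    adj x y] >] = common g x y.
  by rewrite /common /=; case: (adj x y); case: (adj (g x) (g y)).
move: Cx Cy; rewrite /= perfect_forestE// => -[_ [x' _ <-] Xx] [_ [y' _ <-] Xy].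
have [_ xx] := Xi_sub Hg I0 J0 Xx; have [_ yy] := Xi_sub Hg I0 J0 Xy.
have cs := @common_sym T g.
apply/asboolP/idP => [[_ [[z _ <-] Xx1 Xy1 xy]]|xy].
  have [_ zx] := Xi_sub Hg I0 J0 Xx1; have [_ zy] := Xi_sub Hg I0 J0 Xy1.
  by rewrite /common /= (common_embeds zx zy) xy.
exists [set z | reach (common g) x' z]; split=> //; first by exists x'.
  by rewrite (class_eq cs xx) (class_eq cs (reach1 xy)) -(class_eq cs yy).
by case/andP: xy.
Qed.

End BitreeCore.

(** * Double cosets *)

Section DoubleCosets.
Variable T : omega_tree.
Implicit Types (g h k : vperm T) (A B I J S : set T) (R : set (T * T)).

(** The second clause says that [g' * h * g^-1] is an automorphism as well, so [h] compares the
    double cosets of [g] and [g']. *)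
Lemma extend_piso g g' R : Hier g -> Hier g' ->
  piso (bigraph_of g) (bigraph_of g') R -> exists h : vperm T, [/\ AutT h,
    forall x y, adj (g' (h x)) (g' (h y)) = adj (g x) (g y) &
    forall x y, R (x, y) -> h x = y].
Proof.
move=> Hg Hg' pR.
have [U [RU Ud Ur _ Ui]] :=
  back_and_forth (ample_bigraph_of Hg) (ample_bigraph_of Hg') pR.
have /choice[f fP] : forall x, exists y, U (x, y) by move=> x; apply: Ud.
have /choice[f' f'P] : forall y, exists x, U (x, y) by move=> x; apply: Ur.
have fK : cancel f f'.
  by move=> x; have [[_ /(_ erefl) /= ->] _ _] := Ui _ _ (f'P (f x)) (fP x).
have f'K : cancel f' f.
  by move=> y; have [[/(_ erefl) /= -> _] _ _] := Ui _ _ (fP (f' y)) (f'P y).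
exists (VPerm fK f'K); split=> /= x y.
- by have [_ /= -> _] := Ui _ _ (fP x) (fP y).
- by have [_ _ /=] := Ui _ _ (fP x) (fP y); rewrite /pull /= => ->.
- by move=> /RU Rxy; have [[/(_ erefl) /= -> _] _ _] := Ui _ _ (fP x) Rxy.
Qed.

Lemma edge_color_inj a b c d : edge_color a b = edge_color c d -> a = c /\ b = d.
Proof. by case: a; case: b; case: c; case: d. Qed.

Lemma dcoset_of_bitree g g' I J (G : cgraph T) : Hier g -> Hier g' ->
  finite_set I -> finite_set J -> I !=set0 -> J !=set0 ->
  cgraph_equiv I J (bitree g I J) G -> cgraph_equiv I J (bitree g' I J) G ->
  dcoset J g I g'.
Proof.
move=> Hg Hg' fI fJ I0 J0 [l [lb lc lI lJ]] [l' [lb' lc' lI' lJ']].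
rewrite bitree_cset// in lb lc; rewrite bitree_cset// in lb' lc'.
have [lf li ls] := lb; have [lf' li' ls'] := lb'.
pose C := bicore g I J; pose C' := bicore g' I J.
(* The composite of one isomorphism of bi-trees with the inverse of the other. A colour determines
   both adjacencies, so this is a partial isomorphism between cores. *)
pose R := [set u : T * T | [/\ C u.1, C' u.2 & l u.1 = l' u.2]].
have RC : fst @` R = C.
  apply/seteqP; split=> [_ [[x y] [Cx _ _] <-] //|x Cx].
  have [y C'y lxy] := ls' _ (lf _ Cx); exists (x, y) => //.
have RC' : snd @` R = C'.
  apply/seteqP; split=> [_ [[x y] [_ C'y _] <-] //|y C'y].
  have [x Cx lxy] := ls _ (lf' _ C'y); exists (x, y) => //.
have Rcol u v : R u -> R v -> adj u.1 v.1 = adj u.2 v.2 /\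
    adj (g u.1) (g v.1) = adj (g' u.2) (g' v.2).
  move=> [Cu Cu' lu] [Cv Cv' lv]; apply: edge_color_inj.
  rewrite -(bitree_ccol Hg I0 J0)// -(bitree_ccol Hg' I0 J0)//.
  by rewrite -lc// -lc'// lu lv.
have pR : piso (bigraph_of g) (bigraph_of g') R.
  have [i Ii] := I0; split.
  - apply: (@sub_finite_set _ _ (C `*` C')); first by move=> -[x y] [? ? _].
    by apply: finite_setX; apply: finite_bicore.
  - have /seteqP[_ /(_ i)] := RC; case=> [|u Ru _]; last by exists u.
    by apply: sub_bicore; apply: Or31.
  - move=> u v [Cu Cu' lu] [Cv Cv' lv]; split=> uv.
      by apply: li'; rewrite ?inE// -lu -lv uv.
    by apply: li; rewrite ?inE// lu lv uv.
  - by move=> u v Ru Rv; have [] := Rcol _ _ Ru Rv.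
  - by move=> u v Ru Rv; have [] := Rcol _ _ Ru Rv.
  - by rewrite RC; apply: core_bicore.
  - by rewrite RC'; apply: core_bicore.
have [h [hA hg hR]] := extend_piso Hg Hg' pR.
have hV x y : adj (vinv h x) (vinv h y) = adj x y by rewrite -hA !vinvK.
(* This fixes [J] because [h] carries [vinv g u] to [vinv g' u] for [u] in [J]; then [g'] is this
   element times [g] times [h^-1]. *)
exists (g' * h * g^-1)%g.
  split=> [x y|u Ju]; first by rewrite /= hg !vinvK.
  rewrite /= (_ : h _ = vinv g' u) ?vinvK//; apply: hR; split=> /=.
  - by apply: sub_bicore; apply: Or32; rewrite vinvK.
  - by apply: sub_bicore; apply: Or32; rewrite vinvK.
  - by rewrite -[vinv g u]/(cJ (bitree g I J) u) -lJ// lJ'.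
exists (h^-1)%g; last by apply: vpermP => x; rewrite /= vfunK vinvK.
apply: KV; split=> // u Iu; apply: hR; split=> /=.
- by apply: sub_bicore; apply: Or31.
- by apply: sub_bicore; apply: Or31.
- by rewrite -[l u]/(l (cI (bitree g I J) u)) -lI// lI'.
Qed.

Lemma conn_AutT k A : AutT k -> conn (@adj T) A -> conn (@adj T) (k @` A).
Proof.
move=> kA Ac _ _ [x Ax <-] [y Ay <-]; apply/reach_pull.
apply: reach_sub (Ac _ _ Ax Ay) => a b /and3P[ab]; rewrite !inE => Aa Ab.
by apply/and3P; rewrite !inE kA; split=> //; apply: imageP.
Qed.

Lemma core1 A : conn (@adj T) A -> core (bigraph_of (1%g : vperm T)) A.
Proof. by move=> Ac; split. Qed.

(** Extend the identity of [J] to [B], taking [A] as the set of forbidden images of new vertices,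
    and then to an automorphism. *)
Lemma generic_exists J A B : fin_subtree J -> finite_set A -> finite_set B ->
  exists2 k, K J k & forall x, B x -> A (k x) -> J x.
Proof.
move=> [[J0 Jc] fJ] fA fB.
pose R := [set u : T * T | J u.1 /\ u.2 = u.1].
have Rf : fst @` R = J.
  by apply/seteqP; split=> [_ [[x y] [Jx _] <-] //|x Jx]; exists (x, x).
have Rs : snd @` R = J.
  by apply/seteqP; split=> [_ [[x y] [/= Jx ->] <-] //|x Jx]; exists (x, x).
have pR : piso (bigraph_of (1%g : vperm T)) (bigraph_of (1%g : vperm T)) R.
  have [i Ji] := J0; split; rewrite ?Rf ?Rs.
  - apply: (@sub_finite_set _ _ ((fun x => (x, x)) @` J)); last exact: finite_image.
    by move=> [x y] [/= Jx ->]; exists x.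
  - by exists (i, i).
  - by move=> u v [_ ->] [_ ->].
  - by move=> u v [_ ->] [_ ->].
  - by move=> u v [_ ->] [_ ->].
  - exact: core1.
  - exact: core1.
have H1 := @Hier1 T; have aB := ample_bigraph_of H1.
have [Q [RQ pQ BQ QA]] := piso_extend_set aB aB pR fA fB (fun _ _ => Logic.I).
have [h [hA _ hR]] := extend_piso H1 H1 pQ.
exists h; first by split=> // x Jx; apply: hR; apply: RQ.
move=> x /BQ[[y y'] Qy /= yx]; subst y; rewrite (hR _ _ Qy).
by case: (QA _ Qy) => [[]|].
Qed.

(** For generic [k] the trees [A] and [k B] meet exactly in [J], and no edge joins the rest of one
    to the rest of the other. Thus [A] with [k B] is an amalgam over [J] whose isomorphism type is
    the same for all generic [k]. *)
Lemma generic_dcoset J A B k k' : fin_subtree A -> fin_subtree B ->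
  J !=set0 -> J `<=` A -> J `<=` B -> K J k -> K J k' ->
  (forall x, B x -> A (k x) -> J x) -> (forall x, B x -> A (k' x) -> J x) ->
  exists a b, [/\ K A a, K B b & k' = (a * k * b)%g].
Proof.
move=> [[A0 Ac] fA] [[B0 Bc] fB] [j Jj] JA JB [ka kJ] [ka' kJ'] gk gk'.
(* The identity on [A] glued to [k x |-> k' x] on [k B]; its extension [h] is the left factor. *)
pose R := [set u : T * T | A u.1 /\ u.2 = u.1] `|` (fun x => (k x, k' x)) @` B.
have Rf : fst @` R = A `|` k @` B.
  apply/seteqP; split=> [_ [[x y] [[/= Ax _]|[z Bz [<- _]]] <-]|x].
  - by left.
  - by right; exists z.
  - case=> [Ax|[y By <-]]; first by exists (x, x) => //; left.
    by exists (k y, k' y) => //; right; exists y.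
have Rs : snd @` R = A `|` k' @` B.
  apply/seteqP; split=> [_ [[x y] [[/= Ax ->]|[z Bz [_ <-]]] <-]|x].
  - by left.
  - by right; exists z.
  - case=> [Ax|[y By <-]]; first by exists (x, x) => //; left.
    by exists (k y, k' y) => //; right; exists y.
have cross h x y : AutT h -> (forall x, J x -> h x = x) ->
    (forall x, B x -> A (h x) -> J x) -> A x -> B y -> ~ J x -> ~ J y ->
    adj (h y) x = false.
  move=> ha hJ gh Ax By nJx nJy.
  apply: (conn_not_adj (adj_forest T) Ac (conn_AutT ha Bc)) => //.
  - by exists j; split; [exact: JA|exists j; [exact: JB|exact: hJ]].
  - by move=> /(gh _ By).
  - move=> [z Bz hz]; have Jz : J z by apply: gh; rewrite ?hz.
    by apply: nJx; rewrite -hz hJ.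
have crossE x y : A x -> B y -> adj x (k y) = adj x (k' y).
  move=> Ax By.
  have [Jy|nJy] := pselect (J y); first by rewrite kJ// kJ'.
  have [Jx|nJx] := pselect (J x).
    by rewrite -{1}(kJ _ Jx) -{2}(kJ' _ Jx) ka ka'.
  by rewrite adj_sym (cross k)// adj_sym (cross k').
have eqE x y : A x -> B y -> x = k y <-> x = k' y.
  move=> Ax By; split=> xE.
    by have Jy : J y by [apply: gk; rewrite // -xE]; rewrite xE kJ// kJ'.
  by have Jy : J y by [apply: gk'; rewrite // -xE]; rewrite xE kJ// kJ'.
have pR : piso (bigraph_of (1%g : vperm T)) (bigraph_of (1%g : vperm T)) R.
  have rel1 u v : R u -> R v -> adj u.1 v.1 = adj u.2 v.2.
    case: u v => [x x'] [y y'] [[/= Ax ->]|[x0 Bx [<- <-]]]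
      [[/= Ay ->]|[y0 By [<- <-]]] //=.
    - exact: crossE.
    - by rewrite adj_sym (crossE _ _ Ay Bx) adj_sym.
    - by rewrite ka ka'.
  have [a Aa] := A0; split; rewrite ?Rf ?Rs//.
  - rewrite finite_setU; split; last exact: finite_image.
    apply: (@sub_finite_set _ _ ((fun x => (x, x)) @` A)); last exact: finite_image.
    by move=> [x y] [/= Ax ->]; exists x.
  - by exists (a, a); left.
  - move=> [x x'] [y y'] [[/= Ax ->]|[x0 Bx [<- <-]]]
      [[/= Ay ->]|[y0 By [<- <-]]] //=.
    + exact: eqE.
    + by split=> [/esym/(eqE _ _ Ay Bx)|/esym/(eqE _ _ Ay Bx)] ->.
    + by split=> [/(can_inj (@vfunK _ k))|/(can_inj (@vfunK _ k'))] ->.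
  - apply/core1/(conn_setU (@adj_sym T) Ac (conn_AutT ka Bc) (JA _ Jj)).
    by exists j; [exact: JB|exact: kJ].
  - apply/core1/(conn_setU (@adj_sym T) Ac (conn_AutT ka' Bc) (JA _ Jj)).
    by exists j; [exact: JB|exact: kJ'].
have H1 := @Hier1 T; have [h [hA _ hR]] := extend_piso H1 H1 pR.
exists h, (k^-1 * h^-1 * k')%g; split.
- by split=> // x Ax; apply: hR; left.
- split=> [x y|x Bx].
    by rewrite /= -[LHS]ka vinvK -[LHS]hA !vinvK ka'.
  by rewrite /= -(hR (k x) (k' x)) ?vfunK//; right; exists x.
- by apply: vpermP => x; rewrite /= !vinvK.
Qed.

End DoubleCosets.

(** * The product of bi-trees *)

Section Trimming.
Variable T : omega_tree.
Implicit Types (e : rel T) (g k : vperm T) (A B I J : set T).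

(** A simple path never passes through the interior of a vertex with at most one neighbour, since it
    would enter and leave by different neighbours. *)
Lemma conn_remove e A B : symmetric e -> conn e A -> B `<=` A ->
  (forall z u v, A z -> ~ B z -> A u -> A v -> e z u -> e z v -> u = v) ->
  conn e B.
Proof.
move=> es Ac BA leaf x y Bx By.
have [p [ep pl up]] := reach_uniq (Ac _ _ (BA _ Bx) (BA _ By)).
have [ep' Ap] := path_restr ep.
exists p => //; apply: restr_path => // z; rewrite inE => /predU1P[->//|zp].
apply: contrapT => nBz; move: Ap up pl ep'; case/splitPr: zp => p1 p2.
rewrite last_cat cat_path; case: p2 => [|w p2] Ap up /= pl.
  by move=> _; apply: nBz; rewrite pl.
move=> /and4P[_ ez zw _]; have Az : A z by apply: Ap; rewrite mem_cat inE eqxx orbT.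
have Aw : A w by apply: Ap; rewrite mem_cat !inE eqxx !orbT.
have Al : A (last x p1).
  have := mem_last x p1; rewrite inE => /predU1P[->|lp]; first exact: BA.
  by apply: Ap; rewrite mem_cat lp.
have wp : w \in z :: w :: p2 by rewrite !inE eqxx orbT.
move: up; rewrite -cat_cons cat_uniq => /and3P[_ /hasPn/(_ w wp) /negP nw _].
have lw : last x p1 = w by apply: (leaf z) => //; rewrite es.
by apply: nw; have := mem_last x p1; rewrite lw.
Qed.

Definition linked g : rel T := [rel x y | adj x y || adj (g x) (g y)].

(** The counterpart of [trim_step] for a graph drawn inside [T], where a pair carries a colour iff
    it is [linked]. *)
Definition trim g I J A : set T := [set x | A x /\
  ((exists! y, A y /\ linked g x y) -> I x \/ J (g x))].

Lemma conn_step e A x y : conn e A -> A x -> A y -> x <> y ->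
  exists2 z, A z & e x z.
Proof.
move=> Ac Ax Ay xy; have [[|z p]] := Ac _ _ Ax Ay; first by [].
by move=> /andP[/and3P[xz _]]; rewrite inE => Az _ _; exists z.
Qed.

(** Suppose a vertex [x] of the core is trimmed. Connectedness of the core in both trees forces its
    only edge to be black, so [x] carries no mark and the core without [x] is still connected in
    both trees, against minimality. *)
Lemma bicore_trim g I J A : I !=set0 -> bicore g I J `<=` A ->
  bicore g I J `<=` trim g I J A.
Proof.
move=> [i Ii] CA x Cx; split=> [|[y [[Ay xy] y_uniq]]]; first exact: CA.
apply: contrapT => /not_orP[nI nJ].
have [s1 _ _] := adj_forest T; have [s2 _ _] := pull_forest g.
have Ci : bicore g I J i by apply: sub_bicore; apply: Or31.
have xi : x <> i by move=> xi; rewrite xi in nI.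
have leaf z : bicore g I J z -> linked g x z -> z = y.
  by move=> Cz xz; apply/esym/y_uniq; split=> //; apply: CA.
have xy1 : adj x y.
  have [z Cz xz] := conn_step (@bicore_conn1 _ g I J) Cx Ci xi.
  by rewrite -(leaf z)// /linked /= xz.
have xy2 : adj (g x) (g y).
  have [z Cz xz] := conn_step (@bicore_conn2 _ g I J) Cx Ci xi.
  by rewrite /pull /= in xz; rewrite -(leaf z)// /linked /= xz orbT.
have leafC e : subrel e (linked g) -> forall z u v, bicore g I J z ->
    ~ (bicore g I J `\ x) z -> bicore g I J u -> bicore g I J v ->
    e z u -> e z v -> u = v.
  move=> en z u v Cz nz Cu Cv zu zv.
  have zx : z = x by apply: contrapT => zx; apply: nz.
  by subst z; rewrite (leaf u Cu (en _ _ zu)) (leaf v Cv (en _ _ zv)).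
suff /(_ x Cx)[_] : bicore g I J `<=` bicore g I J `\ x by apply.
apply: bicore_min.
- apply: (conn_remove s1 (@bicore_conn1 _ g I J)) => [z []//|].
  by apply: leafC => u v uv; rewrite /linked /= uv.
- apply: (conn_remove s2 (@bicore_conn2 _ g I J)) => [z []//|].
  by apply: leafC => u v uv; rewrite /linked /=; rewrite /pull /= in uv; rewrite uv orbT.
move=> z Mz; split=> [|zx]; first exact: sub_bicore.
rewrite {z}zx in Mz; case: Mz => // -[z xz].
have Cz : bicore g I J z.
  by apply: sub_bicore; apply: Or33; exists x; rewrite adj_sym [adj (g z) _]adj_sym.
have zy : z = y.
  apply: leaf => //; rewrite /linked /=; move: xz.
  by case: (adj x z); case: (adj (g x) (g z)).
by apply: xz; rewrite zy xy1 xy2.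
Qed.

Lemma trim_conn e g I J A : symmetric e -> subrel e (linked g) -> conn e A ->
  conn e (trim g I J A).
Proof.
move=> es en Ac; apply: (conn_remove es Ac) => [x []//|z u v Az nz Au Av zu zv].
have [y [_ y_uniq]] : exists! y, A y /\ linked g z y.
  by apply: contrapT => nv; apply: nz; split.
have <- : y = u by apply: y_uniq; split; [exact: Au|exact: en].
by apply: y_uniq; split; [exact: Av|exact: en].
Qed.

(** A leaf of [A] outside the core is a leaf for both adjacencies, since these agree off the
    core. *)
Lemma trim_proper g I J A : I !=set0 -> finite_set A -> conn (@adj T) A ->
  bicore g I J `<=` A -> A <> bicore g I J ->
  exists2 x, A x & ~ trim g I J A x.
Proof.
move=> [i Ii] fA Ac CA AnC.
have Ci : bicore g I J i by apply: sub_bicore; apply: Or31.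
have [||x [y [Ax nCx Ay xy leaf]]] :=
  conn_leaf (adj_forest T) fA Ac (@bicore_conn1 _ g I J) _ CA.
- by exists i.
- exact/nesym.
exists x => // -[_ /(_ _)[|Ix|Jx]]; last 2 first.
- by apply: nCx; apply: sub_bicore; apply: Or31.
- by apply: nCx; apply: sub_bicore; apply: Or32.
exists y; split=> [|z [Az xz]]; first by rewrite /linked /= xy.
apply/esym/leaf => //; move: xz; rewrite /linked /=.
suff -> : adj (g x) (g z) = adj x z by rewrite orbb.
by apply/esym/(@bicore_agree _ g I J) => -[].
Qed.

(** Each pass removes a surplus vertex as long as there is one, so as many passes as surplus
    vertices are enough. *)
Lemma iter_trim g I J A n : I !=set0 -> finite_set A -> conn (@adj T) A ->
  conn (pull g) A -> bicore g I J `<=` A ->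
  bicore g I J `<=` iter n (trim g I J) A /\
  (#|` fset_set (A `\` bicore g I J)| <= n ->
    iter n (trim g I J) A = bicore g I J).
Proof.
move=> I0; elim: n A => [|n IH] A fA c1 c2 CA.
  split=> //=; rewrite leqn0 cardfs_eq0 => /eqP/fset_set_set0 AC.
  apply/seteqP; split=> // x Ax; apply: contrapT => nCx.
  by have : (A `\` bicore g I J) x by []; rewrite AC//; apply: finite_setD.
have s1 := @adj_sym T; have [s2 _ _] := pull_forest g.
have tA : trim g I J A `<=` A by move=> x [].
have [||||C1 C2] := IH (trim g I J A).
- exact: sub_finite_set fA.
- by apply: trim_conn => // u v uv; rewrite /linked /= uv.
- by apply: trim_conn => // u v; rewrite /linked /pull /= => ->; rewrite orbT.
- exact: bicore_trim.
rewrite iterSr; split=> // An.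
have [AC|AC] := pselect (A = bicore g I J).
  apply: C2; rewrite (_ : _ `\` _ = set0) ?fset_set0 ?cardfs0//.
  by apply/seteqP; split=> // x [/tA]; rewrite AC.
apply: C2; rewrite -ltnS; apply: leq_trans An; apply: card_fset_set_proper.
- exact: finite_setD.
- by move=> x [/tA Ax nCx].
have [x Ax ntx] := trim_proper I0 fA c1 CA AC.
exists x; last by case.
by split=> // Cx; apply: ntx; apply: bicore_trim Cx.
Qed.

End Trimming.

(** * The glued graph drawn inside the tree *)

Section Diamond.
Variables (T : omega_tree) (J1 J2 J3 : set T) (g1 g2 k : vperm T).
Hypotheses (fJ1 : fin_subtree J1) (fJ2 : fin_subtree J2) (fJ3 : fin_subtree J3).
Hypotheses (Hg1 : Hier g1) (Hg2 : Hier g2) (Kk : K J2 k).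

Let C1 := bicore g1 J2 J1.
Let C2 := bicore g2 J3 J2.
Hypothesis generic : forall x, C2 x -> C1 (k (g2 x)) -> J2 (g2 x).

Let D := bitree g1 J2 J1.
Let G := bitree g2 J3 J2.
(** Three trees on the same vertices are compared: [adj], [pull m] in the middle, and [pull g].
    Gamma records the passage from the first to the second, Delta from the second to the third. *)
Let m : vperm T := (k * g2)%g.
Let g : vperm T := (g1 * k * g2)%g.
Let P : set T := C2 `|` m @^-1` C1.

Let J10 : J1 !=set0. Proof. by case: fJ1 => -[]. Qed.
Let J20 : J2 !=set0. Proof. by case: fJ2 => -[]. Qed.
Let J30 : J3 !=set0. Proof. by case: fJ3 => -[]. Qed.
Let Hk : Hier k. Proof. exact: K_Hier Kk. Qed.
Let Hg : Hier g. Proof. by apply: HierM => //; apply: HierM. Qed.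

Let J2C1 x : J2 x -> C1 x.
Proof. by move=> Jx; apply: sub_bicore; apply: Or31. Qed.
Let J2C2 x : J2 (g2 x) -> C2 x.
Proof. by move=> Jx; apply: sub_bicore; apply: Or32. Qed.
Let kJ2 x : J2 x -> k x = x.
Proof. by case: Kk => _; apply. Qed.

Let agree2 x y : ~ (C2 x /\ C2 y) -> adj x y = adj (m x) (m y).
Proof.
move=> /bicore_agree; rewrite /pull /= => ->.
by case: Kk => ka _; rewrite ka.
Qed.

Let agree1 x y : ~ (C1 (m x) /\ C1 (m y)) -> adj (m x) (m y) = adj (g x) (g y).
Proof. by move=> /bicore_agree; rewrite /pull /= => ->. Qed.

Let C2_mid : conn (pull m) C2.
Proof.
move=> x y Cx Cy; apply: reach_sub (bicore_conn2 Cx Cy) => a b /and3P[ab Ca Cb].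
by apply/and3P; split=> //; case: Kk => ka _; rewrite /pull /= ka.
Qed.

Let C1_mid : conn (pull m) (m @^-1` C1).
Proof. exact/conn_preimage/bicore_conn1. Qed.

Let C1_g : conn (pull g) (m @^-1` C1).
Proof.
have H := @conn_preimage T (pull g1) m C1 (@bicore_conn2 _ g1 J2 J1).
exact H.
Qed.

Let shared : exists2 w, C2 w & C1 (m w).
Proof.
have [j Jj] := J20; exists (vinv g2 j); first by apply: J2C2; rewrite vinvK.
by rewrite /= vinvK kJ2//; apply: J2C1.
Qed.

(** The two pieces are connected in the middle tree and share a vertex. The outer trees differ from
    the middle one only on one piece each, so [conn_agree] carries connectedness of [P] over to
    them. *)
Let P_mid : conn (pull m) P.
Proof.
have [s _ _] := pull_forest m; have [w C2w C1w] := shared.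
exact: conn_setU s C2_mid C1_mid C2w C1w.
Qed.

Let P_conn1 : conn (@adj T) P.
Proof.
have [w C2w C1w] := shared.
apply: (conn_agree (@adj_sym T) _ (@bicore_conn1 _ g2 J3 J2) _ P_mid).
- by exists w.
- by move=> x; left.
- exact: agree2.
Qed.

Let P_conn2 : conn (pull g) P.
Proof.
have [s _ _] := pull_forest g; have [w C2w C1w] := shared.
apply: (conn_agree s _ C1_g _ P_mid).
- by exists w.
- by move=> x; right.
- by move=> x y nC; rewrite /pull /= -agree1.
Qed.

Let finP : finite_set P.
Proof.
have [[_ fin1] [_ fin2] [_ fin3]] := And3 fJ1 fJ2 fJ3.
rewrite finite_setU; split; first exact: finite_bicore.
have /(finite_image (vinv m)) : finite_set C1 by exact: finite_bicore.
by apply: sub_finite_set => x Cx; exists (m x) => //; rewrite vfunK.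
Qed.

Let bicore_P : bicore g J3 J1 `<=` P.
Proof.
apply: bicore_min => // x [Jx|Jx|[y xy]].
- by left; apply: sub_bicore; apply: Or31.
- by right; apply: sub_bicore; apply: Or32.
have [xym|xym] := eqVneq (adj x y) (adj (m x) (m y)).
  right; apply: contrapT => nC; apply: xy.
  by rewrite xym agree1// => -[].
left; apply: contrapT => nC; move/eqP: xym; apply.
by rewrite agree2// => -[].
Qed.

Let W : Type := (T + T)%type.

(* The glued graph is realized on [P]: the vertices of Gamma stay in place, those of
   Delta are pulled back along [m]. *)
Let theta (x : T) : W := if pselect (C2 x) then inl x else inr (m x).

Let theta_inl x : C2 x -> theta x = inl x.
Proof. by rewrite /theta; case: pselect. Qed.

Let theta_inr x : ~ C2 x -> theta x = inr (m x).
Proof. by rewrite /theta; case: pselect. Qed.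

Let theta_inj : injective theta.
Proof.
move=> x y; rewrite /theta; do 2 case: pselect => ? //=; first by case.
by move=> [/(can_inj (@vfunK _ k))/(can_inj (@vfunK _ g2))].
Qed.

Let generic' x : C2 x -> C1 (m x) <-> J2 (g2 x).
Proof.
move=> Cx; split=> [/(generic Cx)//|Jx].
by rewrite /= kJ2//; apply: J2C1.
Qed.

Let glue_inrE x : C1 (m x) -> @glue_inr T J2 D G (m x) = theta x.
Proof.
move=> Cx; rewrite /glue_inr; case: pselect => [h|nh].
  case: cid => w [Jw /= wx] /=.
  have Jx : J2 (g2 x) by rewrite -(vfunK k (g2 x)) -[k _]wx -(kJ2 Jw) vfunK.
  by rewrite theta_inl; [rewrite wx /= kJ2// vfunK|apply: J2C2].
rewrite theta_inr// => C2x; apply: nh; exists (m x); split=> //=.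
by have Jx := generic C2x Cx; rewrite kJ2.
Qed.

Let glue_setE : @glue_set T J2 D G = theta @` P.
Proof.
rewrite /glue_set /D /G !bitree_cset//; apply/seteqP; split=> [p|_ [x Px <-]].
  case=> [[x Cx <-]|[y Cy <-]]; first by exists x; [left|rewrite theta_inl].
  rewrite -[y](vinvK m); rewrite -[y](vinvK m) in Cy.
  by exists (vinv m y); [right|rewrite glue_inrE].
have [Cx|nCx] := pselect (C2 x); first by left; exists x => //; rewrite theta_inl.
by case: Px => // Cx; right; exists (m x) => //; rewrite glue_inrE.
Qed.

Let glue_toDE x : P x ->
  @glue_toD T J2 D G (theta x) = if pselect (C1 (m x)) then Some (m x) else None.
Proof.
move=> Px; have [Cx|nCx] := pselect (C2 x); last first.
  by rewrite theta_inr//; case: Px => // Cx; case: pselect.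
rewrite theta_inl//=; case: pselect => [h|nh]; case: pselect => [C1x|nC1x] //.
- case: cid => w [Jw /= <-]; congr Some.
  by rewrite vinvK kJ2.
- case: nC1x; case: h => w [Jw wx]; apply/generic' => //.
  by rewrite -wx /= vinvK.
- case: nh; exists (g2 x); split; first exact/generic'.
  by rewrite /= vfunK.
Qed.

Let glue_fstcolE x y : @glue_fstcol T D G (theta x) (theta y) =
  if pselect (C2 x /\ C2 y) then edge_color (adj x y) (adj (m x) (m y)) else None.
Proof.
case: pselect => [[Cx Cy]|nC]; last first.
  by rewrite /theta; do 2 case: pselect => ? //=; case: nC.
rewrite !theta_inl// /glue_fstcol bitree_ccol//.
by case: Kk => ka _; rewrite /= ka.
Qed.

Let glue_sndcolE x y : P x -> P y ->
  @glue_sndcol T J2 D G (theta x) (theta y) =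
  if pselect (C1 (m x) /\ C1 (m y))
  then edge_color (adj (m x) (m y)) (adj (g x) (g y)) else None.
Proof.
move=> Px Py; rewrite /glue_sndcol !glue_toDE//.
case: (pselect (C1 (m x) /\ _)) => [[Cx Cy]|nC].
  by do 2 case: pselect => // ?; exact: bitree_ccol.
by do 2 case: pselect => // ?; case: nC.
Qed.

Let cross x y : C2 x -> ~ C1 (m x) -> C1 (m y) -> ~ C2 y ->
  adj (m x) (m y) = false.
Proof.
move=> C2x C1x C1y C2y; have [w C2w C1w] := shared.
by apply: (conn_not_adj (pull_forest m) C1_mid C2_mid) => //; exists w.
Qed.

Let glue_ccolE x y : P x -> P y ->
  ccol (@Defs.glue T J2 D G) (theta x) (theta y) = edge_color (adj x y) (adj (g x) (g y)).
Proof.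
move=> Px Py; rewrite /= glue_fstcolE glue_sndcolE//.
(* On pairs in both bi-trees [merge_color] composes comparisons: from (a, b) and (b, c) it makes (a,
   c), which also explains blue followed by red being black. On pairs in only one of them the other
   comparison is an equality. On pairs in neither, [cross] excludes any edge. *)
case: pselect => C2xy; case: pselect => C1xy.
- by case: (adj x y); case: (adj (m x) _); case: (adj (g x) _).
- by rewrite -(agree1 C1xy); case: (adj x y); case: (adj (m x) _).
- by rewrite (agree2 C2xy); case: (adj (m x) _); case: (adj (g x) _).
have xy0 : adj x y = false.
  rewrite (agree2 C2xy); case: Px => [C2x|C1x]; case: Py => [C2y|C1y].
  - by case: C2xy.
  - by apply: cross => // [C1x|C2y]; [apply: C1xy|apply: C2xy].
  - by rewrite adj_sym; apply: cross => // [C1y|C2x]; [apply: C1xy|apply: C2xy].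
  - by case: C1xy.
by rewrite -(agree1 C1xy) -(agree2 C2xy) xy0.
Qed.

Let cIE u : J3 u -> cI (@Defs.glue T J2 D G) u = theta u.
Proof. by move=> Ju; rewrite theta_inl//; apply: sub_bicore; apply: Or31. Qed.

Let cJE u : J1 u -> cJ (@Defs.glue T J2 D G) u = theta (vinv g u).
Proof.
move=> Ju; rewrite -glue_inrE; first by rewrite /= !vinvK.
by rewrite /= !vinvK; apply: sub_bicore; apply: Or32; rewrite vinvK.
Qed.

Let edge_colorP (b c : bool) : edge_color b c <> None <-> b || c.
Proof. by case: b; case: c; split. Qed.

Let valence1E A x : A `<=` P -> A x ->
  @valence1 T J2 D G (theta @` A) (theta x) <-> exists! y, A y /\ linked g x y.
Proof.
move=> AP Ax; have col y : A y ->
    ccol (@Defs.glue T J2 D G) (theta x) (theta y) <> None <-> linked g x y.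
  by move=> Ay; rewrite glue_ccolE; [exact: edge_colorP|exact: AP|exact: AP].
split=> [[_ [[[y Ay <-] /(col _ Ay) xy] y_uniq]]|[y [[Ay xy] y_uniq]]].
  exists y; split=> // z [Az xz]; apply/theta_inj/y_uniq.
  by split; [exists z|exact/col].
exists (theta y); split=> [|_ [[z Az <-] /(col _ Az) xz]].
  by split; [exists y|exact/col].
by rewrite (y_uniq z).
Qed.

Let trim_stepE A : A `<=` P ->
  @trim_step T J1 J2 J3 D G (theta @` A) = theta @` trim g J3 J1 A.
Proof.
move=> AP; have inI x : (cI (@Defs.glue T J2 D G) @` J3) (theta x) <-> J3 x.
  split=> [[u Ju]|Jx]; last by exists x => //; apply: cIE.
  by rewrite cIE// => /theta_inj <-.
have inJ x : (cJ (@Defs.glue T J2 D G) @` J1) (theta x) <-> J1 (g x).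
  split=> [[u Ju]|Jx]; last by exists (g x) => //; rewrite cJE// vfunK.
  by rewrite cJE// => /theta_inj <-; rewrite vinvK.
apply/seteqP; split=> [_ [[x Ax <-] vx]|_ [x [Ax vx] <-]].
  exists x => //; split=> // /(valence1E AP Ax) /vx.
  by case=> [/inI|/inJ]; [left|right].
split; first by exists x.
by move=> /(valence1E AP Ax) /vx[/inI|/inJ]; [left|right].
Qed.

Let iter_trim_sub n : iter n (trim g J3 J1) P `<=` P.
Proof. by elim: n => //= n IH x [/IH]. Qed.

Let iter_trimE n : iter n (@trim_step T J1 J2 J3 D G) (@glue_set T J2 D G) =
  theta @` iter n (trim g J3 J1) P.
Proof.
elim: n => [|n IH]; first exact: glue_setE.
by rewrite !iterS IH trim_stepE//; apply: iter_trim_sub.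
Qed.

Let diamond_csetE :
  cset (diamond J1 J2 J3 D G) = theta @` bicore g J3 J1.
Proof.
have H n := iter_trim n J30 finP P_conn1 P_conn2 bicore_P.
rewrite [cset _]/=; apply/seteqP; split=> [p|_ [x Cx <-] n _].
  set N := #|` fset_set (P `\` bicore g J3 J1)|.
  by move=> /(_ N Logic.I); rewrite iter_trimE (H N).2.
by rewrite iter_trimE; exists x => //; apply: (H n).1.
Qed.

Lemma diamond_equiv :
  cgraph_equiv J3 J1 (bitree g J3 J1) (diamond J1 J2 J3 D G).
Proof.
exists theta; rewrite diamond_csetE bitree_cset//; split.
- split; [by move=> x Cx; exists x|by move=> x y _ _; apply: theta_inj|].
  by move=> _ [x Cx <-]; exists x.
- move=> x y Cx Cy; rewrite bitree_ccol//.
  by apply: glue_ccolE; apply: bicore_P.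
- exact: cIE.
- exact: cJE.
Qed.

End Diamond.

Import Order.TTheory GRing.Theory Num.Theory.
Import numFieldNormedType.Exports.
Local Open Scope ring_scope.

(** * Orthogonal projections *)

Section Hilbert.
Variables (R : realType) (H : completeNormedModType R[i]).
Variable dot : {dot H for Num.conj}.
Hypothesis dotE : norm_from_dot dot.
Implicit Types (x y z u v w : H) (A C : set H).

Local Notation "z %:C" := (real_complex _ z) : ring_scope.

(* The norm of [H] takes its values in [R[i]]. *)
Definition rnorm x : R := complex.Re `|x|.

Lemma rnormE x : `|x| = (rnorm x)%:C.
Proof. by rewrite /rnorm RRe_real// ger0_real. Qed.

Lemma rnorm_ge0 x : 0 <= rnorm x.
Proof. by rewrite -ler0c -rnormE. Qed.

Lemma rnorm_le x y : (rnorm x <= rnorm y) = (`|x| <= `|y|).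
Proof. by rewrite !rnormE lecR. Qed.

Lemma rnorm_eq0 x : rnorm x = 0 -> x = 0.
Proof. by move=> x0; apply: normr0_eq0; rewrite rnormE x0. Qed.

Lemma rnorm0 : rnorm (0 : H) = 0.
Proof. by rewrite /rnorm normr0. Qed.

Lemma rnormN x : rnorm (- x) = rnorm x.
Proof. by rewrite /rnorm normrN. Qed.

Lemma ler_rnormD x y : rnorm (x + y) <= rnorm x + rnorm y.
Proof. by rewrite -lecR rmorphD /= -!rnormE ler_normD. Qed.

Lemma ler_rnormB x y : rnorm x <= rnorm y + rnorm (x - y).
Proof. by rewrite -[x in rnorm x](subrK y) addrC ler_rnormD. Qed.

Lemma rnorm_half x : rnorm (2^-1 *: x) = rnorm x / 2.
Proof.
apply: complexI; rewrite -rnormE normrZ rnormE rmorphM fmorphV /= rmorph_nat.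
by rewrite ger0_norm ?invr_ge0 ?ler0n// mulrC.
Qed.

Lemma rnorm_dot x : (rnorm x ^+ 2)%:C = dot x x.
Proof. by rewrite dotE rnormE rmorphXn. Qed.

Lemma parallelogram x y :
  rnorm (x + y) ^+ 2 + rnorm (x - y) ^+ 2 = 2 * rnorm x ^+ 2 + 2 * rnorm y ^+ 2.
Proof.
apply: complexI; rewrite !rmorphD /= ![(2 * _)%:C]rmorphM /= !rnorm_dot dnormD dnormB.
rewrite rmorph_nat; ring.
Qed.

Lemma dotC x y : dot y x = (dot x y)^*.
Proof. by rewrite hermC /= expr0 mul1r. Qed.

(** The distance from [u] to the line of [v]. Its nonnegativity is the Cauchy-Schwarz inequality,
    and a minimal [u] forces [dot u v] to vanish. *)
Lemma dot_residual u v : v != 0 ->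
  `|u - (dot u v / dot v v) *: v| ^+ 2 = `|u| ^+ 2 - `|dot u v| ^+ 2 / `|v| ^+ 2.
Proof.
move=> v0; rewrite -!dotE dnormB dnormZ linearZr_LR /=.
have vv0 : dot v v != 0 by rewrite dnorm_eq0.
have vvr : (dot v v)^* = dot v v by rewrite -dotC.
have qE : (dot u v / dot v v)^* = (dot u v)^* / dot v v.
  by rewrite rmorphM fmorphV /= vvr.
have rE : ((dot u v)^* / dot v v * dot u v)^* = dot u v / dot v v * (dot u v)^*.
  by rewrite rmorphM -qE /= conjCK.
rewrite qE rE normf_div (ger0_norm (dnorm_ge0 dot v)) !expr_div_n !normCK.

by field; exact: vv0.
Qed.

Lemma cauchy_schwarz u v : `|dot u v| <= `|u| * `|v|.
Proof.
have [->|v0] := eqVneq v 0; first by rewrite linear0r !normr0 mulr0.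
have := exprn_ge0 2 (normr_ge0 (u - (dot u v / dot v v) *: v)).
rewrite dot_residual// subr_ge0 ler_pdivrMr ?exprn_gt0 ?normr_gt0//.
by rewrite -exprMn ler_pXn2r// ?nnegrE ?mulr_ge0.
Qed.

Definition norm_closed A := forall x,
  (forall e : R, 0 < e -> exists2 y, A y & rnorm (x - y) < e) -> A x.

(** The part of convexity that the parallelogram identity uses. *)
Definition midpoint_closed A := forall x y, A x -> A y -> A (2^-1 *: (x + y)).

Lemma midpoint_gap A (d : R) x y : midpoint_closed A ->
  (forall z, A z -> d <= rnorm z ^+ 2) -> A x -> A y ->
  rnorm (x - y) ^+ 2 <= 2 * rnorm x ^+ 2 + 2 * rnorm y ^+ 2 - 4 * d.
Proof.
move=> mA dA Ax Ay; have := dA _ (mA _ _ Ax Ay); have := parallelogram x y.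
rewrite rnorm_half; nra.
Qed.

Lemma complete_rnorm (F : R -> set H) :
  (forall e, 0 < e -> F e !=set0) ->
  (forall e e', e <= e' -> F e `<=` F e') ->
  (forall r, 0 < r -> exists2 e, 0 < e &
     forall x y, F e x -> F e y -> rnorm (x - y) < r) ->
  exists x, forall e r, 0 < e -> 0 < r -> exists2 y, F e y & rnorm (x - y) < r.
Proof.
move=> F0 Fle Fc; pose FF := filter_from [set e : R | 0 < e] F.
have FFP : ProperFilter FF.
  apply: filter_from_proper => [|e /F0//]; apply: filter_from_filter.
    by exists 1 => /=.
  move=> e e' e0 e'0; exists (Num.min e e') => /=; first by rewrite lt_min e0.
  by move=> x Fx; split; apply: Fle Fx; rewrite ge_min lexx ?orbT.
have ballE x (r : R[i]) : 0 < r -> ball x r = [set y | rnorm (x - y) < complex.Re r].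
  move=> r0; have rE : r = (complex.Re r)%:C by rewrite RRe_real// gtr0_real.
  have E y : (`|x - y| < r) = (rnorm (x - y) < complex.Re r).
    by rewrite rnormE [X in _ < X]rE ltcR.
  by rewrite -ball_normE; apply/seteqP; split=> y /=; rewrite E.
have /cvg_ex[l Fl] : cvg FF.
  apply: cauchy_cvg; apply: cauchy_exP => r r0.
  have r0' : 0 < complex.Re r by move: r0; rewrite ltcE => /andP[].
  have [e e0 Fe] := Fc _ r0'; have [x Fx] := F0 _ e0.
  by exists x; rewrite ballE//; exists e => // y Fy; apply: Fe.
exists l => e r e0 r0.
have r0' : 0 < r%:C by rewrite ltcR.
have [e' e'0 Fe'] : FF (ball l r%:C) by apply: Fl; apply: nbhsx_ballx.
have m0 : 0 < Num.min e e' by rewrite lt_min e0.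
have [y Fy] := F0 _ m0; exists y; first by apply: Fle Fy; rewrite ge_min lexx.
have : ball l r%:C y by apply: Fe'; apply: Fle Fy; rewrite ge_min lexx orbT.
by rewrite ballE.
Qed.

Lemma min_norm A : A !=set0 -> norm_closed A -> midpoint_closed A ->
  exists2 x, A x & forall y, A y -> rnorm x <= rnorm y.
Proof.
move=> [a Aa] cA mA; pose Q := (fun x => rnorm x ^+ 2) @` A.
have Qinf : has_inf Q.
  split; first by exists (rnorm a ^+ 2), a.
  by exists 0 => _ [x _ <-]; apply: exprn_ge0; apply: rnorm_ge0.
pose d := inf Q; have dA z : A z -> d <= rnorm z ^+ 2.
  by move=> Az; apply: ge_inf; [case: Qinf|exists z].
pose F e := [set x | A x /\ rnorm x ^+ 2 < d + e].
have [|||l Fl] := @complete_rnorm F.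
- by move=> e /(inf_adherent)/(_ Qinf)[_ [x Ax <-] xe]; exists x.
- by move=> e e' ee x [Ax xe]; split=> //; apply: lt_le_trans xe _; rewrite lerD2l.
(* Two points with squared norm below [d + e] are at squared distance below [4 * e]. *)
- move=> r r0; exists (r ^+ 2 / 4); first by rewrite divr_gt0 ?exprn_gt0.
  move=> x y [Ax xe] [Ay ye]; rewrite -(ltr_pXn2r (n := 2))// ?nnegrE ?rnorm_ge0 ?ltW//.
  have := midpoint_gap mA dA Ax Ay; lra.
exists l; first by apply: cA => e e0; have [y [Ay _] ly] := Fl 1 e ltr01 e0; exists y.
move=> y Ay; rewrite leNgt; apply/negP => yl.
have y0 := rnorm_ge0 y; have dy := dA _ Ay.
(* As [d] is at most the square of [rnorm y], points of [F e] have norm below [rnorm y + r]. One of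
   them within [r] of [l] would give [l] a norm below [rnorm y + 2 * r], which is [rnorm l]. *)
pose r := (rnorm l - rnorm y) / 2; pose e := (rnorm y + r) ^+ 2 - rnorm y ^+ 2.
have r0 : 0 < r by rewrite /r; lra.
have e0 : 0 < e by rewrite /e; nra.
have [z [Az ze] lz] := Fl _ _ e0 r0.
have z0 := rnorm_ge0 z; have lz' := ler_rnormB l z.
have : rnorm z ^+ 2 < (rnorm y + r) ^+ 2 by rewrite /e in ze; lra.
rewrite ltr_pXn2r// ?nnegrE//; last by lra.
move: lz'; rewrite /r in lz *; lra.
Qed.

Lemma min_norm_uniq A x y : midpoint_closed A -> A x -> A y ->
  (forall z, A z -> rnorm x <= rnorm z) -> rnorm y <= rnorm x -> y = x.
Proof.
move=> mA Ax Ay xm yx; apply/eqP; rewrite -subr_eq0; apply/eqP/rnorm_eq0.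
have dA z : A z -> rnorm x ^+ 2 <= rnorm z ^+ 2.
  by move=> /xm xz; rewrite ler_pXn2r// nnegrE rnorm_ge0.
have := midpoint_gap mA dA Ay Ax; have := rnorm_ge0 (y - x).
have := rnorm_ge0 x; have := rnorm_ge0 y; nra.
Qed.

Definition linear_subspace A := A 0 /\
  forall (a : R[i]) x y, A x -> A y -> A (a *: x + y).

Lemma orth_proj_ex A v : linear_subspace A -> norm_closed A ->
  exists w, A w /\ forall u, A u -> dot (v - w) u = 0.
Proof.
move=> [A0 Al] cA.
have AB x y : A x -> A y -> A (x - y).
  by move=> Ax Ay; have := Al (-1) y x Ay Ax; rewrite scaleN1r addrC.
have AZ (a : R[i]) x : A x -> A (a *: x).
  by move=> Ax; have := Al a x 0 Ax A0; rewrite addr0.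
(* The coset of [v] modulo [A]; its vector of least norm is the component of [v] orthogonal to
   [A]. *)
pose B := [set x | A (v - x)].
have [|||m Bm mB] := @min_norm B.
- by exists v; rewrite /B /= subrr.
- move=> x Bx; apply: cA => e /Bx[y By xy]; exists (v - y) => //.
  have -> : v - x - (v - y) = - (x - y) by rewrite !opprB addrC addrA subrK.
  by rewrite rnormN.
- move=> x y Bx By; rewrite /B /=.
  have -> : v - 2^-1 *: (x + y) = 2^-1 *: ((v - x) + (v - y)).
    rewrite addrACA -opprD scalerBr; congr (_ - _).
    by rewrite -[v + v]mulr2n -[v *+ 2]scaler_nat scalerA mulVf ?scale1r ?pnatr_eq0.
  by apply: AZ; have := Al 1 _ _ Bx By; rewrite scale1r.
exists (v - m); split=> // u Au; rewrite opprB addrC subrK.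
have [->|u0] := eqVneq u 0; first by rewrite linear0r.
have /mB : B (m - (dot m u / dot u u) *: u).
  by rewrite /B /= opprB addrCA; apply: Al.
rewrite rnorm_le -(ler_pXn2r (n := 2)) ?nnegrE// dot_residual// lerBrDr gerDl.
rewrite pmulr_lle0 ?invr_gt0 ?exprn_gt0 ?normr_gt0// => mu.
by apply/eqP; rewrite -normr_eq0 -sqrf_eq0 eq_le mu exprn_ge0.
Qed.

Lemma orth_proj_unique A v w w' : linear_subspace A -> A w -> A w' ->
  (forall u, A u -> dot (v - w) u = 0) -> (forall u, A u -> dot (v - w') u = 0) ->
  w = w'.
Proof.
move=> [A0 Al] Aw Aw' wP w'P; apply/eqP; rewrite -subr_eq0 -(dnorm_eq0 dot).
have Aww : A (w - w').
  by have := Al (-1) w' w Aw' Aw; rewrite scaleN1r addrC.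
have E : w - w' = (v - w') - (v - w) by rewrite opprB [RHS]addrC addrA subrK.
by rewrite {1}E linearBl /= wP// w'P// subrr.
Qed.

Lemma orth_projP A v : linear_subspace A -> norm_closed A ->
  A (orth_proj dot A v) /\ forall u, A u -> dot (v - orth_proj dot A v) u = 0.
Proof.
move=> sA cA; rewrite /orth_proj.
exact: (xgetPex 0 (orth_proj_ex v sA cA)).
Qed.

Lemma orth_projE A v w : linear_subspace A -> norm_closed A -> A w ->
  (forall u, A u -> dot (v - w) u = 0) -> orth_proj dot A v = w.
Proof.
move=> sA cA Aw wP; have [Ap pP] := orth_projP v sA cA.
exact: orth_proj_unique sA Ap Aw pP wP.
Qed.

(** Reduces identities between the compressed operators to identities between matrix
    coefficients. *)
Lemma orth_proj_eq A v v' : linear_subspace A -> norm_closed A ->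
  (forall u, A u -> dot v u = dot v' u) -> orth_proj dot A v = orth_proj dot A v'.
Proof.
move=> sA cA vv'; have [Ap pP] := orth_projP v' sA cA.
by apply: orth_projE => // u Au; rewrite linearBl /= vv'// -linearBl /= pP.
Qed.

End Hilbert.

(** * Multiplicativity *)

Section Representation.
Variables (R : realType) (H : completeNormedModType R[i]).
Variable dot : {dot H for Num.conj}.
Hypothesis dotE : norm_from_dot dot.
Variables (T : omega_tree) (rho : vperm T -> H -> H).
Hypothesis rhoP : unitary_rep dot rho.
Implicit Types (x y z u v w : H) (g h k : vperm T) (A B J : set T).

Local Notation "z %:C" := (real_complex _ z) : ring_scope.

Lemma norm_small (a : R[i]) : (forall e : R, 0 < e -> `|a| < e%:C) -> a = 0.
Proof.
move=> small; apply/eqP; apply: contraT => a0.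
have aE : `|a| = (complex.Re `|a|)%:C by rewrite RRe_real// ger0_real.
have : 0 < complex.Re `|a| by rewrite -ltcR -aE normr_gt0.
by move=> /small; rewrite -aE ltxx.
Qed.

Lemma rho_linear g : Hier g -> linear (rho g).
Proof. by case: rhoP => U _ _ /U[]. Qed.

Lemma dot_rho g x y : Hier g -> dot (rho g x) (rho g y) = dot x y.
Proof. by case: rhoP => U _ _ /U[]. Qed.

Lemma rhoM g h x : Hier g -> Hier h -> rho (g * h)%g x = rho g (rho h x).
Proof. by case: rhoP => _ M _ Hg Hh; apply: M. Qed.

Lemma rhoD g x y : Hier g -> rho g (x + y) = rho g x + rho g y.
Proof. by move=> Hg; have := rho_linear Hg 1 x y; rewrite !scale1r. Qed.

Lemma rho0 g : Hier g -> rho g 0 = 0.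
Proof.
move=> Hg; have := rho_linear Hg 1 0 0; rewrite !scale1r addr0 => /eqP.
by rewrite -subr_eq0 opprD addrA subrr add0r oppr_eq0 => /eqP.
Qed.

Lemma rhoZ g a x : Hier g -> rho g (a *: x) = a *: rho g x.
Proof. by move=> Hg; have := rho_linear Hg a x 0; rewrite rho0// !addr0. Qed.

Lemma rhoB g x y : Hier g -> rho g (x - y) = rho g x - rho g y.
Proof. by move=> Hg; rewrite rhoD// -scaleN1r rhoZ// scaleN1r. Qed.

Lemma rnorm_rho g x : Hier g -> rnorm (rho g x) = rnorm x.
Proof.
move=> Hg; apply/eqP; rewrite -(eqrXn2 (n := 2)) ?rnorm_ge0//; apply/eqP/complexI.
by rewrite !(rnorm_dot dotE) dot_rho.
Qed.

Lemma rho1 x : rho 1%g x = x.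
Proof.
have H1 := @Hier1 T; apply/eqP; rewrite -subr_eq0; apply/eqP/rnorm_eq0.
by rewrite -(rnorm_rho _ H1) rhoB// -rhoM// mulg1 subrr rnorm0.
Qed.

Lemma dot_rhol g x y : Hier g -> dot (rho g x) y = dot x (rho (g^-1)%g y).
Proof.
move=> Hg; rewrite -(dot_rho _ _ (HierV Hg)) -rhoM//; last exact: HierV.
by rewrite mulVg rho1.
Qed.

Lemma fixed_subspace J : linear_subspace (fixed rho J).
Proof.
split=> [k Kk|a x y Fx Fy k Kk]; first by rewrite rho0//; apply: K_Hier Kk.
by rewrite rho_linear ?Fx ?Fy//; apply: K_Hier Kk.
Qed.

Lemma fixed_closed J : norm_closed (fixed rho J).
Proof.
move=> x cx k Kk; have Hk := K_Hier Kk.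
apply/eqP; rewrite -subr_eq0; apply/eqP/rnorm_eq0; apply/eqP.
rewrite eq_le rnorm_ge0 andbT; apply/ler_addgt0Pr => e e0; rewrite add0r.
have e20 : 0 < e / 2 by rewrite divr_gt0.
have [y Fy xy] := cx _ e20.
have -> : rho k x - x = rho k (x - y) + (y - x).
  by rewrite rhoB// (Fy _ Kk) addrA subrK.
apply: le_trans (ler_rnormD _ _) _; rewrite rnorm_rho// -[y - x]opprB rnormN.
lra.
Qed.

Lemma fixedS A B : A `<=` B -> fixed rho A `<=` fixed rho B.
Proof. by move=> AB x Fx k /(KS AB)/Fx. Qed.

Lemma dot_fixedl J k x u : K J k -> fixed rho J u -> dot (rho k x) u = dot x u.
Proof. by move=> Kk Fu; rewrite -{1}(Fu _ Kk) dot_rho//; apply: K_Hier Kk. Qed.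

Lemma proj_fixed J v : fixed rho J (orth_proj dot (fixed rho J) v) /\
  forall u, fixed rho J u -> dot (v - orth_proj dot (fixed rho J) v) u = 0.
Proof. exact: (orth_projP dotE v (fixed_subspace J) (@fixed_closed J)). Qed.

(* The closed midpoint-convex hull of the orbit [K J z] contains a vector of least
   norm; by uniqueness it is fixed by [K J], and it is orthogonal to the fixed
   vectors, so it is 0. On the hull the matrix coefficient against [w] is constant
   along generic elements, so its value is the one at 0. *)
Lemma generic_weak J A B k w z : fin_subtree J -> fin_subtree A ->
  fin_subtree B -> J `<=` A -> J `<=` B ->
  fixed rho A w -> fixed rho B z ->
  (forall u, fixed rho J u -> dot z u = 0) ->
  K J k -> (forall t : T, B t -> A (k t) -> J t) -> dot (rho k z) w = 0.
Proof.
move=> tJ tA tB JA JB Fw Fz zJ Kk gk; set c := dot (rho k z) w.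
have J0 : J !=set0 by case: tJ => -[].
have cP h : K J h -> (forall t : T, B t -> A (h t) -> J t) -> dot (rho h z) w = c.
  move=> Kh gh; have [a [b [Ka Kb ->]]] := generic_dcoset tA tB J0 JA JB Kk Kh gk gh.
  have [Ha Hb Hk] := And3 (K_Hier Ka) (K_Hier Kb) (K_Hier Kk).
  have Hak := HierM Ha Hk.
  by rewrite rhoM// (Fz _ Kb) rhoM// (dot_fixedl _ Ka Fw).
pose inv (D : set H) := forall h x, K J h -> D x -> D (rho h x).
(* The hull [E] is the least good set, so any property defining a good set holds at the minimal
   vector [m]. *)
pose good (D : set H) := [/\ norm_closed D, midpoint_closed D, inv D & D z].
pose E := [set x | forall D, good D -> D x].
have gE : good E.
  split=> [x cx D gD|x y Ex Ey D gD|h x Kh Ex D gD|D []//].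
  - case: (gD) => cD _ _ _; apply: cD => e /cx[y Ey xy].
    by exists y => //; apply: Ey.
  - by case: (gD) => _ mD _ _; apply: mD; [apply: Ex|apply: Ey].
  - by case: (gD) => _ _ iD _; apply: iD => //; apply: Ex.
have [cE mE iE zE] := gE.
have [|m Em mP] := min_norm dotE _ cE mE; first by exists z.
have Fm : fixed rho J m.
  move=> h Kh; apply: (min_norm_uniq dotE mE Em (iE _ _ Kh Em) mP).
  by rewrite rnorm_rho//; apply: K_Hier Kh.
have CS y (e : R) : 0 < e -> exists2 d : R, 0 < d &
    forall x, rnorm x < d -> `|dot x y| < e%:C.
  move=> e0; have y0 := rnorm_ge0 y; exists (e / (rnorm y + 1)).
    by rewrite divr_gt0//; lra.
  move=> x xd; apply: le_lt_trans (cauchy_schwarz dotE _ _) _.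
  rewrite !rnormE -rmorphM /= ltcR.
  have x0 := rnorm_ge0 x; move: xd; rewrite ltr_pdivlMr; nra.
have m0 : m = 0.
  apply/eqP; rewrite -(dnorm_eq0 dot); apply/eqP.
  pose D := [set x | forall u, fixed rho J u -> dot x u = 0].
  suff gD : good D by apply: (Em D gD).
  split=> //.
  - move=> x cx u Fu; apply: norm_small => e e0; have [d d0 dP] := CS u e e0.
    have [y Dy xy] := cx d d0; have := dP _ xy.
    by rewrite linearBl /= (Dy _ Fu) subr0.
  - by move=> x y Dx Dy u Fu; rewrite linearZl_LR /= linearDl /= Dx// Dy// addr0 mulr0.
  - by move=> h x Kh Dx u Fu; rewrite (dot_fixedl _ Kh Fu) Dx.
(* The vectors whose coefficient tends to [c] as the finite set [B'] to be kept off [A] grows.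
   Allowing [B'] to depend on [x] and [e] is what makes this set closed and invariant. *)
pose D := [set x | forall e : R, 0 < e -> exists B', finite_set B' /\
  forall h, K J h -> (forall t : T, B' t -> A (h t) -> J t) ->
    `|dot (rho h x) w - c| < e%:C].
have gD : good D.
  split.
  - move=> x cx e e0; have e20 : 0 < e / 2 by rewrite divr_gt0.
    have [d d0 dP] := CS w _ e20; have [y Dy xy] := cx d d0.
    have [B' [fB' hB']] := Dy _ e20; exists B'; split=> // h Kh gh.
    have Hh := K_Hier Kh.
    have -> : dot (rho h x) w - c = dot (rho h (x - y)) w + (dot (rho h y) w - c).
      by rewrite rhoB// linearBl /= addrA subrK.
    apply: le_lt_trans (ler_normD _ _) _.
    rewrite [e]splitr rmorphD /=; apply: ltrD; last exact: hB'.
    by apply: dP; rewrite rnorm_rho.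
  - move=> x y Dx Dy e e0; have [Bx [fBx hBx]] := Dx e e0.
    have [By [fBy hBy]] := Dy e e0; exists (Bx `|` By).
    split=> [|h Kh gh]; first by rewrite finite_setU.
    have Hh := K_Hier Kh.
    have -> : dot (rho h (2^-1 *: (x + y))) w - c =
        2^-1 * ((dot (rho h x) w - c) + (dot (rho h y) w - c)).
      by rewrite rhoZ// rhoD// linearZl_LR /= linearDl /=; field.
    rewrite normrM ger0_norm ?invr_ge0 ?ler0n// mulrC ltr_pdivrMr ?ltr0n//.
    apply: le_lt_trans (ler_normD _ _) _; rewrite mulr2n mulrDr mulr1.
    by apply: ltrD; [apply: hBx => // t tBt; apply: gh; left
      |apply: hBy => // t tBt; apply: gh; right].
  - move=> h x Kh Dx e e0; have [B' [fB' hB']] := Dx e e0.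
    (* If [h'] keeps [h B'] off [A] outside [J], then [h' * h] keeps [B'] off [A] outside [J]. *)
    exists (h @` B'); split; first exact: finite_image.
    move=> h' Kh' gh; rewrite -rhoM; [|exact: K_Hier Kh'|exact: K_Hier Kh].
    apply: hB'; first exact: KM.
    move=> y B'y Ay; have Jhy : J (h y) by apply: gh => //; exists y.
    by case: Kh => _ /(_ _ Jhy)/(can_inj (@vfunK _ h)) hy; rewrite -hy.
  - move=> e e0; exists B; split=> [|h Kh gh]; first by case: tB.
    by rewrite cP// subrr normr0 ltcR.
apply: norm_small => e e0.
(* At [m = 0] the coefficient itself is 0, so its distance to [c] is the modulus of [c]. *)
have [B' [fB' hB']] := Em D gD e e0.
have [h Kh gh] := generic_exists tJ (proj2 tA) fB'.
have := hB' h Kh gh; rewrite m0 rho0; last exact: K_Hier Kh.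
by rewrite linear0l sub0r normrN.
Qed.

End Representation.

(** * Independence of representatives and the value of the product *)

Section Products.
Variable T : omega_tree.
Implicit Types (e : rel T) (g h k a b : vperm T) (A B C I J : set T).

Definition generic J1 J2 J3 g1 g2 k := K J2 k /\
  forall x, bicore g2 J3 J2 x -> bicore g1 J2 J1 (k (g2 x)) -> J2 (g2 x).

Lemma fin_subtree_bicore g I J : Hier g -> fin_subtree I -> finite_set J ->
  fin_subtree (bicore g I J).
Proof.
move=> Hg [[[i Ii] _] fI] fJ; split; last by apply: finite_bicore => //; exists i.
split; last exact: bicore_conn1.
by exists i; apply: sub_bicore; apply: Or31.
Qed.

Lemma image_preimage g A : g @` A = vinv g @^-1` A.
Proof.
apply/seteqP; split=> [_ [x Ax <-]|y Ay]; first by rewrite /= vfunK.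
by exists (vinv g y) => //; rewrite vinvK.
Qed.

Lemma fin_subtree_image_bicore g I J : Hier g -> fin_subtree I -> finite_set J ->
  fin_subtree (g @` bicore g I J).
Proof.
move=> Hg tI fJ; have [[[x Cx] _] fC] := fin_subtree_bicore Hg tI fJ.
split; last exact: finite_image.
split; first by exists (g x), x.
by rewrite image_preimage; apply/conn_image/bicore_conn2.
Qed.

(** Where [e] and [e'] may differ, [k] is the identity; and [k], being injective, sends no other
    pair into [C]. *)
Lemma fixing_transfer e e' C k : (forall x y, e (k x) (k y) = e x y) ->
  (forall x, C x -> k x = x) ->
  (forall x y, ~ (C x /\ C y) -> e x y = e' x y) ->
  forall x y, e' (k x) (k y) = e' x y.
Proof.
move=> ke kC ee' x y; have [[Cx Cy]|nC] := pselect (C x /\ C y).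
  by rewrite !kC.
rewrite -!ee' ?ke//; apply: contra_not nC => -[Ckx Cky].
have ki := can_inj (@vfunK _ k).
by rewrite -(ki _ _ (kC _ Ckx)) -(ki _ _ (kC _ Cky)).
Qed.

Lemma K_bicore_conj g I J a : K (bicore g I J) a -> K J (g * a * g^-1)%g.
Proof.
move=> [aA aC]; split=> [x y|u Ju] /=.
  have := fixing_transfer aA aC (@bicore_agree _ g I J) (vinv g x) (vinv g y).
  by rewrite /pull /= !vinvK.
by rewrite aC ?vinvK//; apply: sub_bicore; apply: Or32; rewrite vinvK.
Qed.

Lemma K_image_bicore_conj g I J b : K (g @` bicore g I J) b ->
  K I (g^-1 * b * g)%g.
Proof.
move=> [bA bC]; split=> [x y|u Iu] /=.
  apply: (@fixing_transfer (pull g) _ (bicore g I J) (g^-1 * b * g)%g)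
    => [{}x {}y|{}x Cx|{}x {}y nC].
  - by rewrite /pull /= !vinvK bA.
  - by rewrite /= bC ?vfunK//; exists x.
  - by rewrite (bicore_agree nC).
by rewrite bC ?vfunK//; exists u => //; apply: sub_bicore; apply: Or31.
Qed.

Lemma conn_eq e e' A : e =2 e' -> conn e A -> conn e' A.
Proof.
move=> ee Ac x y Ax Ay; apply: reach_sub (Ac _ _ Ax Ay) => u v /and3P[uv Au Av].
by apply/and3P; rewrite -ee.
Qed.

Lemma bicore_mull g I J a : K J a -> bicore (a * g)%g I J `<=` bicore g I J.
Proof.
move=> [aA aJ]; apply: bicore_min; first exact: bicore_conn1.
  apply: conn_eq (@bicore_conn2 _ g I J) => x y.
  by rewrite /pull /= aA.
move=> x Mx; apply: sub_bicore; case: Mx => [Ix|Jx|[y xy]].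
- exact: Or31.
- apply: Or32; have ai := can_inj (@vfunK _ a).
  by rewrite -(ai _ _ (aJ _ Jx)).
- by apply: Or33; exists y; rewrite /= aA in xy.
Qed.

Lemma bicore_mulr g I J b : K I b ->
  bicore (g * b)%g I J `<=` b @^-1` bicore g I J.
Proof.
move=> [bA bI]; apply: bicore_min.
- have c1 := @conn_preimage _ _ b _ (@bicore_conn1 _ g I J).
  by apply: conn_eq c1 => x y; apply: bA.
- exact (@conn_preimage _ _ b _ (@bicore_conn2 _ g I J)).
move=> x Mx; apply: sub_bicore; case: Mx => [Ix|Jx|[y xy]].
- by apply: Or31; rewrite bI.
- exact: Or32.
- by apply: Or33; exists (b y); rewrite bA.
Qed.

Section Factors.
Variables (J1 J2 J3 : set T) (g1 g2 : vperm T).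
Hypotheses (tJ1 : fin_subtree J1) (tJ2 : fin_subtree J2) (tJ3 : fin_subtree J3).
Hypotheses (Hg1 : Hier g1) (Hg2 : Hier g2).

(** With [g1' = p g1 q] and [g2' = r g2 s], choose [k'] so that it is generic for the new pair while
    [q k' r] is generic for the old one. Then [generic_dcoset] writes [q k' r] as [a k b], and
    conjugation by [g1] and [g2] moves [a] into K(J1) and [b] into K(J3). *)
Lemma generic_factor g1' g2' k : dcoset J1 g1 J2 g1' -> dcoset J2 g2 J3 g2' ->
  generic J1 J2 J3 g1 g2 k ->
  exists2 k', generic J1 J2 J3 g1' g2' k' &
    dcoset J1 (g1 * k * g2)%g J3 (g1' * k' * g2')%g.
Proof.
move=> [p Kp [q Kq E1]] [r Kr [s Ks E2]] [Kk gk].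
have [Hp Hq] := (K_Hier Kp, K_Hier Kq); have [Hr Hs] := (K_Hier Kr, K_Hier Ks).
have Hg1' : Hier g1' by rewrite -E1; apply: HierM => //; apply: HierM.
have Hg2' : Hier g2' by rewrite -E2; apply: HierM => //; apply: HierM.
have [fJ1 fJ2 fJ3] := And3 (proj2 tJ1) (proj2 tJ2) (proj2 tJ3).
have tA := fin_subtree_bicore Hg1 tJ2 fJ1.
have tA' := fin_subtree_bicore Hg1' tJ2 fJ1.
have tB := fin_subtree_image_bicore Hg2 tJ3 fJ2.
have tB' := fin_subtree_image_bicore Hg2' tJ3 fJ2.
set A := bicore g1 J2 J1 in tA; set A' := bicore g1' J2 J1 in tA'.
set B := g2 @` _ in tB; set B' := g2' @` _ in tB'.
have ki h : injective h by exact: (can_inj (@vfunK _ h)).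
(* Both requirements are met at once by keeping the union of [B'] and [r B] off the union of [A']
   and [q^-1 A]. *)
have [k' Kk' gk'] : exists2 k', K J2 k' &
    forall x, (B' `|` r @` B) x -> (A' `|` vinv q @` A) (k' x) -> J2 x.
  apply: generic_exists => //; rewrite finite_setU; split;
    [exact: (proj2 tA')|apply: finite_image; exact: (proj2 tA)
    |exact: (proj2 tB')|apply: finite_image; exact: (proj2 tB)].
exists k'.
  by split=> // x Cx Ax; apply: gk'; [left; exists x|left].
have J2A : J2 `<=` A by move=> x Jx; apply: sub_bicore; apply: Or31.
have J2B : J2 `<=` B.
  move=> x Jx; exists (vinv g2 x); last by rewrite vinvK.
  by apply: sub_bicore; apply: Or32; rewrite vinvK.
have gB x : B x -> A (k x) -> J2 x by move=> [y Cy <-]; apply: gk.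
have gB' x : B x -> A ((q * k' * r)%g x) -> J2 x.
  move=> Bx Ax; have : J2 (r x).
    apply: gk'; first by right; exists x.
    by right; exists (q (k' (r x))) => //; rewrite vfunK.
  by case: Kr => _ rJ /[dup] Jrx /rJ /ki rx; rewrite -rx.
have [a [b [Ka Kb E]]] := generic_dcoset tA tB (tJ2.1).1 J2A J2B Kk
  (KM (KM Kq Kk') Kr) gB gB'.
exists (p * (g1 * a * g1^-1))%g; first by apply: KM => //; apply: (K_bicore_conj Ka).
exists ((g2^-1 * b * g2) * s)%g.
  by apply: KM => //; apply: (K_image_bicore_conj Kb).
rewrite -E1 -E2.
have -> : (p * g1 * q * k' * (r * g2 * s) = p * g1 * (q * k' * r) * g2 * s)%g.
  by rewrite !mulgA.
by rewrite E; apply: vpermP => x /=; rewrite vfunK vinvK.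
Qed.

Lemma generic_mul p s k : K J1 p -> K J3 s -> generic J1 J2 J3 g1 g2 k ->
  generic J1 J2 J3 (p * g1)%g (g2 * s)%g k.
Proof.
move=> Kp Ks [Kk gk]; split=> // x /(bicore_mulr Ks) Cx /(bicore_mull Kp).
exact: gk.
Qed.

(** An element of [odot] has the bi-tree of some [g1' k' g2'] with [k'] generic, hence lies in its
    double coset. Conversely, outer factors in K(J1) and K(J3) are absorbed into [g1] and [g2], for
    which [k] stays generic. *)
Lemma odotE k : generic J1 J2 J3 g1 g2 k ->
  odot J1 J2 J3 (dcoset J1 g1 J2) (dcoset J2 g2 J3) =
  dcoset J1 (g1 * k * g2)%g J3.
Proof.
move=> gk; have [fJ1 fJ2 fJ3] := And3 (proj2 tJ1) (proj2 tJ2) (proj2 tJ3).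
have [J10 J20 J30] := And3 tJ1.1.1 tJ2.1.1 tJ3.1.1.
apply/seteqP; split=> [g [Hg [g1' [g2' [D1 D2 equiv]]]]|_ [p Kp [s Ks <-]]].
  have [k' [Kk' gk'] [p Kp [s Ks E]]] := generic_factor D1 D2 gk.
  have Hg1' : Hier g1'.
    by case: D1 => a /K_Hier Ha [b /K_Hier Hb <-]; apply: HierM => //; apply: HierM.
  have Hg2' : Hier g2'.
    by case: D2 => a /K_Hier Ha [b /K_Hier Hb <-]; apply: HierM => //; apply: HierM.
  have equiv' := diamond_equiv tJ1 tJ2 tJ3 Hg1' Hg2' Kk' gk'.
  have Hg' : Hier (g1' * k' * g2')%g.
    by apply: HierM => //; apply: HierM => //; apply: K_Hier Kk'.
  have [p' Kp' [s' Ks' E']] := dcoset_of_bitree Hg' Hg fJ3 fJ1 J30 J10 equiv' equiv.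
  exists (p' * p)%g; first exact: KM.
  by exists (s * s')%g; [exact: KM|rewrite -E' -E !mulgA].
have [Hp Hs] := (K_Hier Kp, K_Hier Ks).
have [Kk gk'] := generic_mul Kp Ks gk.
have Hk := K_Hier Kk.
split; first by do 4 (apply: HierM => //).
exists (p * g1)%g, (g2 * s)%g; split.
- by exists p => //; exists 1%g; [exact: K1|rewrite mulg1].
- by exists 1%g; [exact: K1|exists s => //; rewrite mul1g].
have := diamond_equiv tJ1 tJ2 tJ3 (HierM Hp Hg1) (HierM Hg2 Hs) Kk gk'.
by rewrite !mulgA.
Qed.

Lemma generic_ex : exists k, generic J1 J2 J3 g1 g2 k.
Proof.
have tA := fin_subtree_bicore Hg1 tJ2 (proj2 tJ1).
have tB := fin_subtree_image_bicore Hg2 tJ3 (proj2 tJ2).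
have [k Kk gk] := generic_exists tJ2 (proj2 tA) (proj2 tB).
by exists k; split=> // x Cx; apply: gk; exists x.
Qed.

End Factors.
End Products.

(** * The compressed operators compose *)

Section Category.
Variables (R : realType) (H : completeNormedModType R[i]).
Variable dot : {dot H for Num.conj}.
Hypothesis dotE : norm_from_dot dot.
Variables (T : omega_tree) (rho : vperm T -> H -> H).
Hypothesis rhoP : unitary_rep dot rho.
Implicit Types (u v w : H) (g h k : vperm T) (A B J : set T).

Lemma rho_tilde_dcosetE J1 J2 g g' v : Hier g -> dcoset J1 g J2 g' ->
  fixed rho J2 v -> rho_tilde dot rho J1 g' v = rho_tilde dot rho J1 g v.
Proof.
move=> Hg [p Kp [s Ks <-]] Fv; have [Hp Hs] := (K_Hier Kp, K_Hier Ks).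
have Hpg := HierM Hp Hg.
rewrite /rho_tilde (rhoM rhoP)// (Fv _ Ks) (rhoM rhoP)//.
apply: (orth_proj_eq dotE (fixed_subspace rhoP J1) (fixed_closed dotE rhoP (J := J1))).
by move=> u Fu; rewrite (dot_fixedl rhoP _ Kp Fu).
Qed.

Lemma rho_tilde_mul J1 J2 J3 g1 g2 k v : fin_subtree J1 -> fin_subtree J2 ->
  fin_subtree J3 -> Hier g1 -> Hier g2 -> generic J1 J2 J3 g1 g2 k ->
  fixed rho J3 v ->
  rho_tilde dot rho J1 g1 (rho_tilde dot rho J2 g2 v) =
  rho_tilde dot rho J1 (g1 * k * g2)%g v.
Proof.
move=> tJ1 tJ2 tJ3 Hg1 Hg2 [Kk gk] Fv; have Hk := K_Hier Kk.
have tA := fin_subtree_bicore Hg1 tJ2 (proj2 tJ1).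
have tB := fin_subtree_image_bicore Hg2 tJ3 (proj2 tJ2).
have J2A : J2 `<=` bicore g1 J2 J1 by move=> x Jx; apply: sub_bicore; apply: Or31.
have J2B : J2 `<=` g2 @` bicore g2 J3 J2.
  move=> x Jx; exists (vinv g2 x); last by rewrite vinvK.
  by apply: sub_bicore; apply: Or32; rewrite vinvK.
set z := rho g2 v; set pz := rho_tilde dot rho J2 g2 v.
have [Fpz zP] := proj_fixed dotE rhoP J2 z.
have Fz : fixed rho (g2 @` bicore g2 J3 J2) z.
  move=> b Kb; have Hb := K_Hier Kb; have := Fv _ (K_image_bicore_conj Kb).
  have Hgb := HierM (HierV Hg2) Hb.
  rewrite (rhoM rhoP)// (rhoM rhoP)//; last exact: HierV.
  move=> /(congr1 (rho g2)); rewrite -(rhoM rhoP)//; last exact: HierV.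
  by rewrite mulgV (rho1 dotE rhoP).
apply: (orth_proj_eq dotE (fixed_subspace rhoP J1) (fixed_closed dotE rhoP (J := J1))).
move=> u Fu; pose w := rho (g1^-1)%g u.
have Fw : fixed rho (bicore g1 J2 J1) w.
  move=> a Ka; have Ha := K_Hier Ka; have := Fu _ (K_bicore_conj Ka).
  have Hga := HierM Hg1 Ha; have HV := HierV Hg1.
  rewrite (rhoM rhoP)// (rhoM rhoP)// => /(congr1 (rho (g1^-1)%g)).
  by rewrite -(rhoM rhoP)// mulVg (rho1 dotE rhoP).
have Hgk := HierM Hg1 Hk.
rewrite (rhoM rhoP)// (rhoM rhoP)// !(dot_rhol dotE rhoP _ _ Hg1) -/w -/z.
apply/eqP; rewrite eq_sym -subr_eq0 -linearBl /=; apply/eqP.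
(* [rho k] fixes the projection [pz], so only [z - pz], orthogonal to H(J2), is left, and its
   generic coefficients vanish. *)
have -> : rho k z - pz = rho k (z - pz) by rewrite (rhoB rhoP)// (Fpz _ Kk).
apply: (generic_weak dotE rhoP tJ2 tA tB J2A J2B Fw _ zP Kk).
  have [F0 Fl] := fixed_subspace rhoP (g2 @` bicore g2 J3 J2).
  have := Fl (-1) pz z (fixedS J2B Fpz) Fz.
  by rewrite scaleN1r addrC.
by move=> _ [x Cx <-]; apply: gk.
Qed.

End Category.

Theorem theorem4p10 (R : realType) (H : completeNormedModType R[i])
    (dot : {dot H for Num.conj}) (T : omega_tree) (rho : vperm T -> H -> H) :
  norm_from_dot dot ->
  unitary_rep dot rho ->
  [/\ (* the operator only depends on the double coset *)
      forall (J1 J2 : set T) (g g' : vperm T),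
        fin_subtree J1 -> fin_subtree J2 -> Hier g -> dcoset J1 g J2 g' ->
        forall v, fixed rho J2 v ->
          rho_tilde dot rho J1 g' v = rho_tilde dot rho J1 g v,
      (* it maps H(J2) to H(J1) *)
      forall (J1 J2 : set T) (D : set (vperm T)),
        fin_subtree J1 -> fin_subtree J2 -> is_dcoset J1 J2 D ->
        forall v, fixed rho J2 v ->
          fixed rho J1 (rho_tilde_dcoset dot rho J1 D v),
      (* identity morphisms *)
      forall J : set T, fin_subtree J ->
        forall v, fixed rho J v ->
          rho_tilde_dcoset dot rho J (dcoset J 1%g J) v = v &
      (* composition *)
      forall (J1 J2 J3 : set T) (D1 D2 : set (vperm T)),
        fin_subtree J1 -> fin_subtree J2 -> fin_subtree J3 ->
        is_dcoset J1 J2 D1 -> is_dcoset J2 J3 D2 ->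
        is_dcoset J1 J3 (odot J1 J2 J3 D1 D2) /\
        forall v, fixed rho J3 v ->
          rho_tilde_dcoset dot rho J1 D1 (rho_tilde_dcoset dot rho J2 D2 v) =
          rho_tilde_dcoset dot rho J1 (odot J1 J2 J3 D1 D2) v].
Proof.
move=> dotE rhoP.
(* The representative picked by [xget] lies in the double coset, which contains [g], so the default
   value never occurs. *)
have repr (J J' : set T) g : dcoset J g J' (xget 1%g (dcoset J g J')).
  apply: xgetPex; exists g; exists 1%g; first exact: K1.
  by exists 1%g; [exact: K1|rewrite mulg1 mul1g].
have tildeE (J J' : set T) g v : Hier g -> fixed rho J' v ->
    rho_tilde_dcoset dot rho J (dcoset J g J') v = rho_tilde dot rho J g v.
  by move=> Hg Fv; apply: (rho_tilde_dcosetE dotE rhoP Hg (repr J J' g) Fv).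
have projP (J : set T) := proj_fixed dotE rhoP J.
split.
- move=> J1 J2 g g' _ _ Hg D v Fv; exact: (rho_tilde_dcosetE dotE rhoP Hg D Fv).
- by move=> J1 J2 _ _ _ [g Hg ->] v Fv; apply: (projP _ _).1.
- move=> J tJ v Fv; rewrite tildeE//; last exact: Hier1.
  rewrite /rho_tilde (rho1 dotE rhoP).
  apply: (orth_projE dotE (fixed_subspace rhoP J) (fixed_closed dotE rhoP (J := J)))
    => //.
  by move=> u _; rewrite subrr linear0l.
move=> J1 J2 J3 _ _ tJ1 tJ2 tJ3 [g1 Hg1 ->] [g2 Hg2 ->].
have [k gk] := generic_ex tJ1 tJ2 tJ3 Hg1 Hg2.
have Hk : Hier k by case: gk => /K_Hier.
have Hg : Hier (g1 * k * g2)%g by apply: HierM => //; apply: HierM.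
rewrite (odotE tJ1 tJ2 tJ3 Hg1 Hg2 gk); split; first by exists (g1 * k * g2)%g.
move=> v Fv; rewrite !tildeE//; last exact: (projP _ _).1.
exact: (rho_tilde_mul dotE rhoP tJ1 tJ2 tJ3 Hg1 Hg2 gk Fv).
Qed.
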